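(* Let $\mathcal{P}\subset\mathbf{R}^d$ be a $d$-dimensional lattice polytope, and let $A_{\mathcal{P}}$ be its solid-angle polynomial. Write \[ \operatorname{Solid}_{\mathcal{P}}(z):=\sum_{t\ge 0}A_{\mathcal{P}}(t)\,z^t=\frac{a_dz^d+a_{d-1}z^{d-1}+\cdots+a_0}{(1-z)^{d+1}}. \] Then $a_j>0$ for $j=1,2,\dots,d$, and $a_0=0$.
   Context: A lattice polytope is a convex polytope all of whose vertices lie in $\mathbf{Z}^d$. For a polytope $\mathcal{Q}\subset\mathbf{R}^d$ and $\mathbf{x}\in\mathbf{R}^d$, the solid angle of $\mathbf{x}$ with respect to $\mathcal{Q}$ is $\omega_{\mathcal{Q}}(\mathbf{x}):=\lim_{r\to0}\operatorname{vol}(B(r,\mathbf{x})\cap\mathcal{Q})/\operatorname{vol}(B(r,\mathbf{x}))$, where $B(r,\mathbf{x})$ is the $d$-dimensional ball of radius $r$ centered at $\mathbf{x}$. For positive integers $t$, $A_{\mathcal{P}}(t):=\sum_{\mathbf{x}\in\mathbf{Z}^d}\omega_{t\mathcal{P}}(\mathbf{x})$, where $t\mathcal{P}=\{t\mathbf{x}:\mathbf{x}\in\mathcal{P}\}$. It is known (Ehrhart–Macdonald) that for a lattice polytope this agrees with a polynomial in $t$ of degree $d$; $A_{\mathcal{P}}$ denotes that polynomial (so $A_{\mathcal{P}}(0)$ is its value at $0$), and consequently $\operatorname{Solid}_{\mathcal{P}}(z)$ is a rational function which can be written with denominator $(1-z)^{d+1}$ and a numerator polynomial of degree at most $d$. 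*)

(* Defs.v *)
From HB Require Import structures.
From mathcomp Require Import all_boot all_order all_algebra.
From mathcomp Require Import all_classical all_reals all_analysis.

Set Implicit Arguments.
Unset Strict Implicit.
Unset Printing Implicit Defensive.

Import Order.TTheory GRing.Theory Num.Theory.
Import numFieldNormedType.Exports.

Local Open Scope classical_set_scope.
Local Open Scope ring_scope.

Definition convex_hull (R : realType) (d : nat) (S : set 'rV[R]_d) :
  set 'rV[R]_d := smallest (@convex_set R 'rV[R]_d) S.

Definition polytope (R : realType) (d : nat) (P : set 'rV[R]_d) : Prop :=
  exists2 S : set 'rV[R]_d, finite_set S & P = convex_hull S.

Definition vertex (R : realType) (d : nat) (P : set 'rV[R]_d) (x : 'rV[R]_d) :
    Prop :=
  P x /\ forall (y z : 'rV[R]_d) (t : R), P y -> P z -> 0 < t -> t < 1 ->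
    x = t *: y + (1 - t) *: z -> y = x /\ z = x.

Definition lattice_point (R : realType) (d : nat) (x : 'rV[int]_d) :
  'rV[R]_d := map_mx intr x.

Definition lattice_polytope (R : realType) (d : nat) (P : set 'rV[R]_d) :
    Prop :=
  polytope P /\ forall x, vertex P x -> range (@lattice_point R d) x.

(* The dimension of a nonempty set is that of its affine hull; [U] below is the
   direction of that hull, the span of the differences of points of [P]. *)
Definition has_dim (R : realType) (d : nat) (P : set 'rV[R]_d) (k : nat) :
    Prop :=
  P !=set0 /\
  exists2 U : {vspace 'rV[R]_d}, \dim U = k &
    forall V : {vspace 'rV[R]_d},
      (U <= V)%VS <-> (forall x y, P x -> P y -> x - y \in V).

(* [d]-dimensional Lebesgue measure on Borel sets, as the [d]-fold product of
   [lebesgue_measure]: as in the library's product measure, the measure of a set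
   is the integral of the measures of its sections (here along coordinate 0). *)
Fixpoint vol (R : realType) (d : nat) : set 'rV[R]_d -> \bar R :=
  match d with
  | 0 => fun A => (\1_A (0 : 'rV[R]_0))%:E
  | d'.+1 => fun A =>
      (\int[lebesgue_measure]_(s in [set: R])
         vol [set v : 'rV[R]_d' | A (row_mx (s%:M : 'rV[R]_1) v)])%E
  end.

(* The library's norm and balls on ['rV[R]_d] are those of the sup norm, hence
   an explicit Euclidean ball. *)
Definition eball (R : realType) (d : nat) (r : R) (x : 'rV[R]_d) :
  set 'rV[R]_d :=
  [set y | Num.sqrt (\sum_(i < d) (y ord0 i - x ord0 i) ^+ 2) <= r].

Definition solid_angle (R : realType) (d : nat) (Q : set 'rV[R]_d)
    (x : 'rV[R]_d) : R :=
  lim (fine (vol (eball r x `&` Q)) / fine (vol (eball r x)) @[r --> 0^'+]).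

Definition dilate (R : realType) (d : nat) (t : nat) (P : set 'rV[R]_d) :
  set 'rV[R]_d := [set t%:R *: x | x in P].

(* The sum has finite support when [P] is bounded. *)
Definition solid_angle_sum (R : realType) (d : nat) (P : set 'rV[R]_d)
    (t : nat) : R :=
  \sum_(x \in [set: 'rV[int]_d])
    solid_angle (dilate t P) (lattice_point R x).

(* A polynomial is determined by its values at the positive integers, so at most
   one [A] satisfies this; its value at 0 is that of the polynomial. *)
Definition is_solid_angle_poly (R : realType) (d : nat) (P : set 'rV[R]_d)
    (A : {poly R}) : Prop :=
  forall t : nat, (0 < t)%N -> A.[t%:R] = solid_angle_sum P t.

(* Equality of formal power series
   [\sum_(t >= 0) u t * z ^ t = (num z) / (den z)], for [den`_0] a unit, with
   the denominator cleared. *)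
Definition gen_fun_eq (R : realType) (u : nat -> R) (num den : {poly R}) :
    Prop :=
  forall n : nat, \sum_(i < n.+1) u i * den`_(n - i) = num`_n.

(* Main.v *)
(* The solid angle of [t P] at [x] is the probability, over a uniform direction [u]
   in the unit ball, that [x + r u] lies in [t P] for small [r].  A generic choice
   of heights triangulates [P] into lattice simplices, and for almost every [u] the
   lattice points thus counted are those of disjoint half-open simplices: in the
   simplex [S] one removes the facets in [I], the set of facets that [u] leaves.
   So [A_P] is an average of Ehrhart functions of half-open simplices, the pair
   [(S, I)] having weight [p_(S, I)], and multiplying the generating function of
   one of them by [(1 - z)^(d + 1)] leaves the count [h_j] of the lattice points of
   height [j] in a half-open parallelepiped.  Hence [a_j] is the sum of the
   [p_(S, I) h_j].  Since the barycentric coordinates of a direction sum to 0, [I]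
   is neither empty nor all of [S] (almost surely), which gives [a_0 = 0]; every
   other [I] has positive weight, and the sum of its vertices is a lattice point of
   height [#|I|], which gives [a_j > 0] for [1 <= j <= d]. *)

Require Import Defs.
From HB Require Import structures.
From mathcomp Require Import all_boot all_order all_algebra finmap.
From mathcomp Require Import all_classical all_reals all_analysis measurable_realfun.
From mathcomp Require Import ring lra.

Set Implicit Arguments.
Unset Strict Implicit.
Unset Printing Implicit Defensive.

Import Order.TTheory GRing.Theory Num.Theory.
Import numFieldNormedType.Exports.

Local Open Scope ring_scope.

(** * Simplicial cones *)

Lemma mxDZE (R : pzRingType) p q (A B : 'M[R]_(p, q)) c i j :
  (A + c *: B) i j = A i j + c * B i j.
Proof. by rewrite !mxE. Qed.

Lemma mxBE (R : pzRingType) p q (A B : 'M[R]_(p, q)) i j :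
  (A - B) i j = A i j - B i j.
Proof. by rewrite !mxE. Qed.

Section Bases.
Variables (R : realFieldType) (m n : nat) (W : 'M[R]_(n, m)).

(* [C] maps a vector to its coordinates on the basis [row i W], [i \in S]. *)
Definition is_basis (S : {set 'I_n}) (C : 'M[R]_(m, n)) : Prop :=
  [/\ C *m W = 1%:M,
      forall i, i \in S -> row i W *m C = delta_mx 0 i &
      forall i k, i \notin S -> C k i = 0].

Lemma is_basis_unique S C (l : 'rV[R]_n) : is_basis S C ->
  (forall i, i \notin S -> l 0 i = 0) -> l *m W *m C = l.
Proof.
move=> [_ bS _] l0; rewrite -mulmxA mulmx_sum_row [RHS]row_sum_delta.
apply: eq_bigr => i _; case: (boolP (i \in S)) => iS; last by rewrite l0 ?scale0r.
by rewrite row_mul bS.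
Qed.

Lemma is_basis_out S C (x : 'rV[R]_m) i : is_basis S C -> i \notin S ->
  (x *m C) 0 i = 0.
Proof. by move=> [_ _ b0] iS; rewrite mxE big1 // => k _; rewrite b0 ?mulr0. Qed.

Lemma is_basis_mulK S C (x : 'rV[R]_m) : is_basis S C -> x *m C *m W = x.
Proof. by move=> [CW _ _]; rewrite -mulmxA CW mulmx1. Qed.

Lemma is_basis_uniqC S C C' : is_basis S C -> is_basis S C' -> C = C'.
Proof.
move=> b b'; apply/row_matrixP => k; rewrite !rowE.
rewrite -[RHS](is_basis_unique b); first by rewrite (is_basis_mulK _ b').
by move=> i iS; rewrite (is_basis_out _ b').
Qed.

Lemma is_basis_card S C : is_basis S C -> #|S| = m.
Proof.
move=> [CW bS b0]; apply/eqP; rewrite -(eqr_nat R).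
have := mxtrace_mulC C W; rewrite CW mxtrace1 => ->.
rewrite /mxtrace (bigID (mem S)) /= [X in _ == _ + X]big1 ?addr0; last first.
  by move=> i iS; rewrite mxE big1 // => k _; rewrite b0 ?mulr0.
rewrite (eq_bigr (fun=> 1)) ?sumr_const // => i iS.
have /matrixP/(_ 0 i) := bS _ iS.
rewrite -row_mul mxE => ->; by rewrite mxE !eqxx.
Qed.

Definition exchange (C : 'M[R]_(m, n)) (i j : 'I_n) : 'M[R]_(m, n) :=
  C + ((row j W *m C) 0 i)^-1 *: (col i C *m (delta_mx 0 j - row j W *m C)).

Lemma exchangeE (C : 'M[R]_(m, n)) (i j : 'I_n) (x : 'rV[R]_m) :
  x *m exchange C i j = x *m C +
    ((x *m C) 0 i / (row j W *m C) 0 i) *: (delta_mx 0 j - row j W *m C).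
Proof.
rewrite /exchange mulmxDr -scalemxAr mulmxA colE mulmxA -colE.
by rewrite [col i (x *m C)]mx11_scalar mul_scalar_mx scalerA [col i _ _ _]mxE [_ / _]mulrC.
Qed.

Lemma is_basis_exchange S C i j : is_basis S C -> i \in S ->
  (row j W *m C) 0 i != 0 -> j != i -> is_basis (j |: (S :\ i)) (exchange C i j).
Proof.
move=> b iS mu0 ji; have [CW bS b0] := b.
split.
- rewrite /exchange mulmxDl CW -scalemxAl -mulmxA mulmxBl -rowE.
  by rewrite (is_basis_mulK _ b) subrr mulmx0 scaler0 addr0.
- move=> k; rewrite !inE exchangeE => /orP[/eqP->|/andP[ki kS]].
    by rewrite divff // scale1r addrC subrK.
  by rewrite bS // [X in X / _]mxE (eq_sym i) (negPf ki) andbF mul0r scale0r addr0.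
- move=> k l; rewrite !inE negb_or negb_and negbK => /andP[kj kiS].
  have E (mu : 'rV[R]_n) a : (C + a *: (col i C *m (delta_mx 0 j - mu))) l k =
      C l k + a * (C l i * - mu 0 k).
    by rewrite !mxE big_ord1 !mxE (negPf kj) andbF sub0r.
  rewrite /exchange E; have [->|ki] := eqVneq k i.
    by rewrite mulrN mulrN mulrCA mulVf // mulr1 subrr.
  move: kiS; rewrite (negPf ki) /= => kS.
  by rewrite b0 // (is_basis_out _ b kS) oppr0 !mulr0 addr0.
Qed.

Lemma is_basis_outside S C i j : is_basis S C -> i \in S ->
  (row j W *m C) 0 i != 0 -> j != i -> j \notin S.
Proof.
move=> [_ bS _] iS mu0 ji; apply/negP => jS; case/negP: mu0.
by rewrite bS // mxE (eq_sym i) (negPf ji) andbF.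
Qed.

Lemma ex_is_basis : row_full W -> exists S C, is_basis S C.
Proof.
move=> fW; pose f := fullrankfun fW.
have finj : injective f by exact: fullrankfun_inj.
have fu : rowsub f W \in unitmx by exact: fullrowsub_unit.
pose E : 'M[R]_(m, n) := rowsub f 1%:M.
have EW : E *m W = rowsub f W by rewrite /E mul_rowsub_mx mul1mx.
exists [set i | i \in codom f], (invmx (rowsub f W) *m E); split.
- by rewrite -mulmxA EW mulVmx.
- move=> i; rewrite inE => /codomP[k ->].
  have -> : row (f k) W = row k (rowsub f W) by apply/rowP => l; rewrite !mxE.
  rewrite mulmxA -row_mul mulmxV // -row_mul mul1mx.
  by apply/rowP => l; rewrite !mxE eqxx /= eq_sym.
- move=> i k; rewrite inE => iS; rewrite mxE big1 // => p _.
  rewrite [E _ _]mxE mxE; case: eqVneq => [e|]; last by rewrite mulr0.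
  by case/negP: iS; rewrite -e; apply/codomP; exists p.
Qed.

(* Adding a multiple of a generator to a point of a simplicial cone: move in the
   direction of that generator inside the cone until a coordinate vanishes,
   then exchange. *)
Lemma cone_add S C (x : 'rV[R]_m) (c : R) j : is_basis S C ->
  (forall i, 0 <= (x *m C) 0 i) -> 0 <= c ->
  exists S' C', is_basis S' C' /\ forall i, 0 <= ((x + c *: row j W) *m C') 0 i.
Proof.
move=> b l0 c0; set l := x *m C; set mu := row j W *m C.
have lE C' : (x + c *: row j W) *m C' = x *m C' + c *: (row j W *m C').
  by rewrite mulmxDl scalemxAl.
case: (boolP [exists i, (mu 0 i < 0) && (l 0 i + c * mu 0 i < 0)]); last first.
  rewrite negb_exists => /forallP H; exists S, C; split => // i.
  rewrite lE -/l -/mu mxDZE; move: (H i); rewrite negb_and -!leNgt.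
  case/orP => //; move: (l0 i); rewrite -/l => li mui.
  by rewrite addr_ge0 // mulr_ge0.
case/existsP => i1 i1P.
have [i iP imin] := @arg_minP _ _ _ i1
  (fun i => (mu 0 i < 0) && (l 0 i + c * mu 0 i < 0)) (fun i => - l 0 i / mu 0 i) i1P.
case/andP: iP => mui li.
have iS : i \in S.
  by apply: contraLR mui => iS; rewrite /mu (is_basis_out _ b) // ltxx.
have ji : j != i.
  apply: contraTneq mui => ji; have [_ bS _] := b.
  by rewrite /mu ji bS // mxE !eqxx /= -leNgt ler01.
have mu0 : mu 0 i != 0 by rewrite lt_eqF.
pose th := - l 0 i / mu 0 i.
have th0 : 0 <= th.
  by rewrite /th mulNr oppr_ge0 mulr_ge0_le0 // invr_le0 ltW.
have thc : th < c.
  rewrite /th ltr_ndivrMr //; lra.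
exists (j |: (S :\ i)), (exchange C i j); split; first exact: is_basis_exchange.
have b' := is_basis_exchange b iS mu0 ji.
have bj : row j W *m exchange C i j = delta_mx 0 j.
  by have [_ -> //] := b'; rewrite !inE eqxx.
move=> k; rewrite lE bj exchangeE -/l -/mu.
have -> : l 0 i / mu 0 i = - th by rewrite /th mulNr opprK.
rewrite !mxDZE mxBE [delta_mx _ _ _ _]mxE eqxx /=.
have [->|kj] := eqVneq k j; last first.
  rewrite mulr0 addr0 sub0r mulrNN.
  case: (ltP (mu 0 k) 0) => muk; last by rewrite addr_ge0 // ?l0 // mulr_ge0.
  case: (ltP (l 0 k + c * mu 0 k) 0) => lk.
    have := imin k; rewrite muk lk => /(_ isT); rewrite -/th ler_ndivlMr // => h.
    lra.
  apply: (le_trans lk); rewrite lerD2l ler_wnM2r //; exact: ltW.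
have jS : j \notin S by exact: (is_basis_outside b iS).
rewrite /l /mu !(is_basis_out _ b jS) /=; lra.
Qed.

Lemma caratheodory (l : 'rV[R]_n) : row_full W -> (forall i, 0 <= l 0 i) ->
  exists S C, is_basis S C /\ forall i, 0 <= (l *m W *m C) 0 i.
Proof.
move=> fW l0; rewrite mulmx_sum_row.
elim: (index_enum _) => [|j s [S [C [b ge0]]]].
  have [S [C b]] := ex_is_basis fW; exists S, C; split => // i.
  by rewrite big_nil mul0mx mxE.
by rewrite big_cons addrC; exact: cone_add b ge0 (l0 j).
Qed.


Definition basis_coord (S : {set 'I_n}) : 'M[R]_(m, n) :=
  if pselect (exists C, is_basis S C) is left e then projT1 (cid e) else 0.

Lemma basis_coordP S C : is_basis S C -> basis_coord S = C.
Proof.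
move=> b; rewrite /basis_coord; case: pselect => [e|[]]; last by exists C.
exact: is_basis_uniqC (projT2 (cid e)) b.
Qed.

Variable h : 'cV[R]_n.

Definition generic_height := forall S C j, is_basis S C -> j \notin S ->
  (row j W *m C *m h) 0 0 != h j 0.

Definition lower_basis S C := is_basis S C /\
  forall j, j \notin S -> (row j W *m C *m h) 0 0 < h j 0.

(* Linear programming: a basis minimizing the height [x *m C *m h] over the point
   [x] is dual feasible, since otherwise a simplex pivot decreases the height. *)
Lemma ex_lower_basis (x : 'rV[R]_m) (u : 'cV[R]_m) :
  W *m u = const_mx 1 -> generic_height ->
  (forall S C i, is_basis S C -> i \in S -> (x *m C) 0 i != 0) ->
  (exists S C, is_basis S C /\ forall i, 0 <= (x *m C) 0 i) ->
  exists S C, lower_basis S C /\ forall i, 0 <= (x *m C) 0 i.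
Proof.
move=> Wu gen xgen [S0 [C0 [b0 x0]]].
pose P S := `[< is_basis S (basis_coord S) /\ forall i, 0 <= (x *m basis_coord S) 0 i >].
have P0 : P S0 by apply/asboolP; rewrite (basis_coordP b0).
have [S /asboolP[b l0] Smin] :=
  @arg_minP _ _ _ S0 P (fun S => (x *m basis_coord S *m h) 0 0) P0.
set C := basis_coord S in b l0 Smin *; exists S, C; split => //; split => // j jS.
rewrite ltNge; apply/negP => hj.
set mu := row j W *m C; set l := x *m C in l0 Smin *.
have {}hj : h j 0 < (mu *m h) 0 0.
  by rewrite lt_neqAle hj eq_sym (gen _ _ _ b jS).
have [i1 i1P] : exists i, 0 < mu 0 i.
  apply/existsP; rewrite -[X in is_true X]negbK negb_exists; apply/negP => /forallP H.
  have : (mu *m W *m u) 0 0 <= 0.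
    rewrite -mulmxA Wu mxE sumr_le0 // => i _; rewrite [const_mx _ _ _]mxE mulr1.
    by have := H i; rewrite -leNgt.
  by rewrite (is_basis_mulK _ b) -row_mul Wu !mxE ler10.
have [i mui imin] := @arg_minP _ _ _ i1
  (fun i => 0 < mu 0 i) (fun i => l 0 i / mu 0 i) i1P.
have iS : i \in S.
  by apply: contraLR mui => iS; rewrite /mu (is_basis_out _ b) // ltxx.
have ji : j != i by apply: contraNneq jS => ->.
have mu0 : mu 0 i != 0 by rewrite gt_eqF.
have b' := is_basis_exchange b iS mu0 ji.
pose th := l 0 i / mu 0 i.
have th0 : 0 < th by rewrite divr_gt0 // lt_def (xgen _ _ _ b iS) /=.
have l'E : x *m exchange C i j = l + th *: (delta_mx 0 j - mu).
  by rewrite exchangeE.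
have : P (j |: (S :\ i)).
  apply/asboolP; rewrite (basis_coordP b'); split => // k.
  rewrite l'E mxDZE mxBE [delta_mx _ _ _ _]mxE eqxx /=.
  have [->|kj] := eqVneq k j.
    by rewrite /l /mu !(is_basis_out _ b jS) /= oppr0 addr0 add0r mulr1 ltW.
  rewrite sub0r mulrN; case: (leP (mu 0 k) 0) => muk.
    by rewrite addr_ge0 // oppr_ge0 mulr_ge0_le0 // ltW.
  by rewrite subr_ge0 -ler_pdivlMr // imin.
move/Smin; rewrite (basis_coordP b') l'E mulmxDl -scalemxAl mulmxBl -rowE.
rewrite leNgt => /negP; apply.
rewrite mxDZE gtrDl mxBE [row j h 0 0]mxE pmulr_rlt0 // subr_lt0.
exact: hj.
Qed.

Lemma mulmx_height S C (l : 'rV[R]_n) : lower_basis S C ->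
  (forall i, 0 <= l 0 i) ->
  (l *m W *m C *m h) 0 0 <= (l *m h) 0 0 ?= iff [forall i, (i \notin S) ==> (l 0 i == 0)].
Proof.
move=> [b lo] l0.
have onS i : i \in S -> (row i W *m C *m h) 0 0 = h i 0.
  by move=> iS; have [_ bS _] := b; rewrite bS // -rowE mxE.
have -> : (l *m W *m C *m h) 0 0 = \sum_i l 0 i * (row i W *m C *m h) 0 0.
  rewrite -!mulmxA mulmx_sum_row summxE; apply: eq_bigr => i _.
  by rewrite mxE row_mul mulmxA.
rewrite [(l *m h) 0 0]mxE.
apply/leifP; case: ifP => [/forallP H|/negbT].
  apply/eqP/eq_bigr => i _; case: (boolP (i \in S)) => iS; first by rewrite onS.
  by have := H i; rewrite iS => /eqP ->; rewrite !mul0r.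
rewrite negb_forall => /existsP[i]; rewrite negb_imply => /andP[iS li].
rewrite (bigD1 i) //= [ltRHS](bigD1 i) //=; apply: ltr_leD.
  by rewrite ltr_pM2l ?lo // lt_def li l0.
apply: ler_sum => k _; case: (boolP (k \in S)) => kS; first by rewrite onS.
by rewrite ler_wpM2l ?l0 // ltW ?lo.
Qed.

Lemma lower_basis_unique S C S' C' (x : 'rV[R]_m) :
  lower_basis S C -> lower_basis S' C' ->
  (forall i, i \in S -> 0 < (x *m C) 0 i) ->
  (forall i, i \in S' -> 0 < (x *m C') 0 i) -> S = S'.
Proof.
move=> lb lb' p p'; have [b _] := lb; have [b' _] := lb'.
have ge S1 C1 : is_basis S1 C1 -> (forall i, i \in S1 -> 0 < (x *m C1) 0 i) ->
    forall i, 0 <= (x *m C1) 0 i.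
  move=> b1 p1 i; case: (boolP (i \in S1)) => iS; first exact/ltW/p1.
  by rewrite (is_basis_out _ b1).
have := mulmx_height lb (ge _ _ b' p').
have := mulmx_height lb' (ge _ _ b p).
rewrite (is_basis_mulK x b) (is_basis_mulK x b') => le1 le2.
have e : (x *m C' *m h) 0 0 = (x *m C *m h) 0 0.
  by apply/eqP; rewrite eq_le (leif_le le1) (leif_le le2).
have := eq_leif le1; have := eq_leif le2; rewrite e eqxx => /esym/forallP s2 /esym/forallP s1.
apply/setP => i; apply/idP/idP => iS.
  by apply: contraLR (p _ iS) => iS'; have := s1 i; rewrite iS' => /eqP ->; rewrite ltxx.
by apply: contraLR (p' _ iS) => iS'; have := s2 i; rewrite iS' => /eqP ->; rewrite ltxx.
Qed.

End Bases.

Lemma exists_nonroot (R : numDomainType) (p : {poly R}) : p != 0 ->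
  exists x : R, p.[x] != 0.
Proof.
move=> p0; pose s := [seq i%:R : R | i <- iota 0 (size p)].
have us : uniq s by rewrite map_inj_uniq ?iota_uniq //; exact: mulrIn (oner_neq0 R).
case: (boolP (all (root p) s)) => [/(max_poly_roots p0)/(_ us)|].
  by rewrite size_map size_iota ltnn.
by rewrite -has_predC => /hasP[x _ /= px]; exists x.
Qed.

(* Points of the moment curve avoid any finite family of hyperplanes. *)
Lemma ex_generic_height (R : realFieldType) (m n : nat) (W : 'M[R]_(n, m)) :
  exists h, generic_height W h.
Proof.

pose q S (j : 'I_n) : 'rV[R]_n := row j W *m basis_coord W S - delta_mx 0 j.
pose F := \prod_(Sj : {set 'I_n} * 'I_n | rVpoly (q Sj.1 Sj.2) != 0)
  rVpoly (q Sj.1 Sj.2).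
have [x Fx] : exists x, F.[x] != 0.
  by apply: exists_nonroot; apply/prodf_neq0.
exists (\col_i x ^+ i) => S C j b jS.
have qE : rVpoly (q S j) != 0.
  apply: contraTneq isT => /(congr1 (@poly_rV _ n)); rewrite rVpolyK linear0.
  move/rowP/(_ j); rewrite /q (basis_coordP b) mxBE (is_basis_out _ b jS) !mxE.
  by move/eqP; rewrite !eqxx sub0r oppr_eq0 oner_eq0.
move: Fx; rewrite /F horner_prod => /prodf_neq0/(_ (S, j) qE) /=.
rewrite horner_poly.
have -> : \sum_(i < n) (if insub (i : nat) is Some i then q S j 0 i else 0) * x ^+ i =
   (row j W *m C *m \col_i x ^+ i) 0 0 - (\col_i x ^+ i : 'cV[R]_n) j 0.
  transitivity ((q S j *m \col_i x ^+ i) 0 0).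
    by rewrite mxE; apply: eq_bigr => i _; rewrite valK [X in _ = _ * X]mxE.
  by rewrite /q mulmxBl (basis_coordP b) -rowE mxBE [row _ _ _ _]mxE.
by rewrite subr_eq0.
Qed.

Local Open Scope classical_set_scope.
Local Open Scope ring_scope.

(** * Volume *)

(* An alias of ['rV[R]_d], to carry the product sigma-algebra. *)
Definition rvec (R : realType) (d : nat) : Type := 'rV[R]_d.
HB.instance Definition _ (R : realType) (d : nat) := Pointed.on (rvec R d).

Section RvecMeasurable.
Context {R : realType} (d : nat).

Definition coord_preimages : set (set (rvec R d)) :=
  [set B | exists (i : 'I_d) (A : set (measurableTypeR R)),
     measurable A /\ B = [set x : rvec R d | A (x ord0 i)]].

HB.instance Definition _ := @isMeasurable.Build (sigma_display coord_preimages)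
  (rvec R d) <<s coord_preimages >> (@sigma_algebra0 _ setT coord_preimages)
  (@sigma_algebraC _ coord_preimages) (@sigma_algebra_bigcup _ setT coord_preimages).

Lemma measurable_coord (i : 'I_d) :
  measurable_fun [set: rvec R d] (fun x : rvec R d => x ord0 i : measurableTypeR R).
Proof.
move=> _ A mA; rewrite setTI; apply: sub_sigma_algebra.
by exists i, A.
Qed.

Lemma measurable_rvecP d1 (T : measurableType d1) (f : T -> rvec R d) :
  (forall i : 'I_d, measurable_fun [set: T] (fun t => f t ord0 i : measurableTypeR R)) ->
  measurable_fun [set: T] f.
Proof.
move=> mf; apply: (@measurability _ _ _ _ _ f coord_preimages) => //.
move=> _ [_ [i [A [mA ->]]] <-].
exact: mf.
Qed.

End RvecMeasurable.

Lemma measurable_row_mx (R : realType) (d : nat) :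
  measurable_fun [set: measurableTypeR R * rvec R d]
    (fun p => row_mx (p.1%:M : 'rV[R]_1) p.2 : rvec R d.+1).
Proof.
apply: measurable_rvecP => i.
case: (split_ordP (i : 'I_(1 + d))) => j {i}->.
  rewrite [X in measurable_fun _ X](_ : _ = fst) //.
  by apply/funext => -[s v] /=; rewrite [LHS](row_mxEl _ _ 0 j) ord1 mxE eqxx mulr1n.
rewrite [X in measurable_fun _ X](_ : _ = (fun x : rvec R d => x ord0 j : measurableTypeR R) \o snd).
  by apply: measurableT_comp => //; exact: measurable_coord.
by apply/funext => -[s v] /=; exact: (row_mxEr _ _ 0 j).
Qed.


Lemma measurable_preimage d1 d2 (T1 : measurableType d1) (T2 : measurableType d2)
    (f : T1 -> T2) (A : set T2) :
  measurable_fun [set: T1] f -> measurable A -> measurable (f @^-1` A).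
Proof. by move=> mf mA; rewrite -[X in measurable X]setTI; exact: mf. Qed.

Section VolStep.
Context {R : realType} (d : nat).
Variable m : {sigma_finite_measure set (rvec R d) -> \bar R}.
Let f : measurableTypeR R * rvec R d -> rvec R d.+1 :=
  fun p => row_mx (p.1%:M : 'rV[R]_1) p.2.
Let mf : measurable_fun [set: measurableTypeR R * rvec R d] f.
Proof. exact: measurable_row_mx. Qed.

Definition vol_step : set (rvec R d.+1) -> \bar R :=
  fun A => (\int[lebesgue_measure]_(s in [set: R])
    m [set v : 'rV[R]_d | A (row_mx (s%:M : 'rV[R]_1) v)])%E.

Lemma vol_stepE A : vol_step A = (lebesgue_measure \x m)%E (f @^-1` A).
Proof.
rewrite /vol_step /product_measure1; apply: eq_integral => s _ /=.
by congr (m _); apply/seteqP; split => v; rewrite /xsection /= in_setE.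
Qed.

Let vol_step0 : vol_step set0 = 0.
Proof. by rewrite vol_stepE preimage_set0 measure0. Qed.

Let vol_step_ge0 A : (0 <= vol_step A)%E.
Proof. by rewrite vol_stepE. Qed.

Let vol_step_sigma : semi_sigma_additive vol_step.
Proof.
move=> F mF tF mUF.
rewrite [X in X @ _ --> _](_ : _ = fun n => (\sum_(0 <= i < n) (lebesgue_measure \x m) (f @^-1` F i))%E); last first.
  by apply/funext => n; apply: eq_bigr => i _; rewrite vol_stepE.
rewrite vol_stepE preimage_bigcup.
apply: (@measure_semi_sigma_additive _ _ _ (lebesgue_measure \x m)%E).
- by move=> n; exact: measurable_preimage.
- apply/trivIsetP => /= i j _ _ ij; rewrite -preimage_setI.
  by move/trivIsetP : tF => /(_ _ _ _ _ ij) ->//; rewrite preimage_set0.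
- by rewrite -preimage_bigcup; exact: measurable_preimage.
Qed.

HB.instance Definition _ := isMeasure.Build _ _ _ vol_step
  vol_step0 vol_step_ge0 vol_step_sigma.

Let vol_step_sigma_finite : sigma_finite setT vol_step.
Proof.
have /sigma_finiteP[F [TF ndF Foo]] := sigma_finiteT (@lebesgue_measure R).
have /sigma_finiteP[G [TG ndG Goo]] := sigma_finiteT m.
pose g (v : rvec R d.+1) : measurableTypeR R * rvec R d :=
  ((lsubmx (v : 'rV_(1 + d))) 0 0, rsubmx (v : 'rV_(1 + d))).
have mg : measurable_fun setT g.
  apply/measurable_fun_pairP; split.
    rewrite [X in measurable_fun _ X](_ : _ = fun v : rvec R d.+1 => v ord0 ord0).
      exact: measurable_coord.
    by apply/funext => v /=; rewrite mxE; congr (v _ _); apply/val_inj.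
  apply: measurable_rvecP => i.
  rewrite [X in measurable_fun _ X](_ : _ = fun v : rvec R d.+1 => v ord0 (rshift 1 i)).
    exact: measurable_coord.
  by apply/funext => v /=; rewrite mxE.
have gf : cancel f g.
  move=> [s v]; rewrite /f /g /= row_mxKl row_mxKr mxE eqxx mulr1n //.
exists (fun n => g @^-1` (F n `*` G n)).
  apply/seteqP; split => // v _.
  have [k _ Fk] : (\bigcup_i F i) (g v).1 by rewrite -TF.
  have [l _ Gl] : (\bigcup_i G i) (g v).2 by rewrite -TG.
  exists (maxn k l) => //; split.
    by move: Fk; apply/subsetPset/ndF/leq_maxl.
  by move: Gl; apply/subsetPset/ndG/leq_maxr.
move=> n; have [mFn Fn] := Foo n; have [mGn Gn] := Goo n.
have mFG : measurable (F n `*` G n) by exact: measurableX.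
split; first exact: measurable_preimage.
rewrite vol_stepE -comp_preimage (_ : g \o f = id); last exact/funext/gf.
by rewrite preimage_id product_measure1E// lte_mul_pinfty// ge0_fin_numE.
Qed.

HB.instance Definition _ := Measure_isSigmaFinite.Build _ _ _ vol_step
  vol_step_sigma_finite.

End VolStep.

Fixpoint vol_measure (R : realType) (d : nat) :
    {sigma_finite_measure set (rvec R d) -> \bar R} :=
  match d with
  | 0 => dirac (0 : rvec R 0)
  | d'.+1 => vol_step (vol_measure R d')
  end.

Lemma vol_measureE (R : realType) (d : nat) (A : set 'rV[R]_d) :
  vol A = vol_measure R d A.
Proof.
elim: d A => [|d IH] A //=.
by apply: eq_integral => s _; rewrite IH.
Qed.

Section LebesgueAffine.
Context {R : realType} (r a : R).
Hypothesis r0 : 0 < r.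
Let phi : measurableTypeR R -> measurableTypeR R := fun s => r^-1 * (s - a).

Let mphi : measurable_fun [set: measurableTypeR R] phi.
Proof. by apply: measurable_funM => //; apply: measurable_funB. Qed.

Lemma lebesgue_measure_affine (A : set (measurableTypeR R)) : measurable A ->
  lebesgue_measure (phi @^-1` A) = (r%:E * lebesgue_measure A)%E.
Proof.
move=> mA; have ri0 : 0 <= r^-1 by rewrite invr_ge0 ltW.
suff -> : lebesgue_measure A = (r^-1%:E * lebesgue_measure (phi @^-1` A))%E.
  by rewrite muleA -EFinM divff ?gt_eqF // mul1e.
rewrite (@lebesgue_measure_unique R (mscale (NngNum ri0) (pushforward lebesgue_measure phi))) //.
move=> _ [[x y]] _ <-.
transitivity (r^-1%:E * lebesgue_measure (phi @^-1` `]x, y]%classic))%E; last by [].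
have -> : phi @^-1` `]x, y]%classic = `]r * x + a, r * y + a]%classic.
  apply/seteqP; split => s; rewrite /phi /= !in_itv /=.
    by rewrite ![r^-1 * _]mulrC ltr_pdivlMr // ler_pdivrMr // ltrBrDr lerBlDr ![_ * r]mulrC.
  by rewrite ![r^-1 * _]mulrC ltr_pdivlMr // ler_pdivrMr // ltrBrDr lerBlDr ![_ * r]mulrC.
rewrite !lebesgue_measure_itv /= !lte_fin ltrD2r ltr_pM2l //.
case: ifP => // _; last by rewrite mule0.
rewrite -!EFinB -EFinM; congr EFin; field; exact: lt0r_neq0.
Qed.

Lemma ge0_integral_affine (f : measurableTypeR R -> \bar R) :
  measurable_fun [set: measurableTypeR R] f -> (forall s, 0 <= f s)%E ->
  (\int[lebesgue_measure]_(s in [set: R]) f (phi s) =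
   r%:E * \int[lebesgue_measure]_(s in [set: R]) f s)%E.
Proof.
move=> mf f0.
have r0' : 0 <= r by exact: ltW.
transitivity (\int[pushforward lebesgue_measure phi]_(s in [set: measurableTypeR R]) f s)%E.
  by rewrite ge0_integral_pushforward // preimage_setT.
rewrite (@eq_measure_integral _ _ _ _ (mscale (NngNum r0') lebesgue_measure)) //=.
  by rewrite ge0_integral_mscale.
by move=> A mA _; rewrite /pushforward lebesgue_measure_affine.
Qed.

End LebesgueAffine.

Lemma row_mx_ord0 (R : pzSemiRingType) d (s : R) (v : 'rV[R]_d) :
  (row_mx (s%:M : 'rV[R]_1) v : 'rV_d.+1) 0 ord0 = s.
Proof.
have -> : ord0 = lshift d 0 :> 'I_(1 + d) by exact/val_inj.
by rewrite [LHS](row_mxEl _ _ 0 0) mxE.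
Qed.

Lemma row_mx_lift (R : pzSemiRingType) d (s : R) (v : 'rV[R]_d) j :
  (row_mx (s%:M : 'rV[R]_1) v : 'rV_d.+1) 0 (lift ord0 j) = v 0 j.
Proof.
have -> : lift ord0 j = rshift 1 j :> 'I_(1 + d) by exact/val_inj.
exact: (row_mxEr _ _ 0 j).
Qed.

Lemma rsubmx_lift (R : Type) d (a : 'rV[R]_d.+1) j :
  rsubmx (a : 'rV_(1 + d)) 0 j = a 0 (lift ord0 j).
Proof. by rewrite mxE; congr (a _ _); apply/val_inj. Qed.

Lemma row_mx_affine (R : realType) d (s : R) (v : 'rV[R]_d) r (a : 'rV[R]_(1 + d)) :
  r *: (row_mx (s%:M : 'rV[R]_1) v - a) =
  row_mx ((r * (s - a 0 0))%:M : 'rV[R]_1) (r *: (v - rsubmx a)).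
Proof.
rewrite -[in LHS](hsubmxK a) opp_row_mx add_row_mx scale_row_mx.
congr row_mx; rewrite [lsubmx a]mx11_scalar -raddfB /= scale_scalar_mx mxE.
by congr (_ * (_ - a _ _))%:M; apply/val_inj.
Qed.

Lemma vol_affine (R : realType) d (r : R) (a : 'rV[R]_d) (E : set (rvec R d)) :
  0 < r -> measurable E ->
  (vol_measure R d [set y | E (r^-1 *: (y - a) : 'rV[R]_d)] = (r ^+ d)%:E * vol_measure R d E)%E.
Proof.
move=> r0; elim: d a E => [|d IH] a E mE.
  by rewrite expr0 mul1e /= /dirac !indicE; congr ((_ : bool)%:R%:E); congr (_ \in _);
   apply/funext => y /=; rewrite thinmx0 [y]thinmx0.
rewrite /= /vol_step.
pose f (s : measurableTypeR R) := vol_measure R d [set v : 'rV[R]_d | E (row_mx (s%:M : 'rV[R]_1) v)].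
have mfib s : measurable ([set v | E (row_mx (s%:M : 'rV[R]_1) v)] : set (rvec R d)).
  rewrite [X in measurable X](_ : _ =
    xsection ((fun p : measurableTypeR R * rvec R d => row_mx (p.1%:M : 'rV[R]_1) p.2 : rvec R d.+1) @^-1` E) s).
    by apply: measurable_xsection; apply: measurable_preimage => //; exact: measurable_row_mx.
  by apply/seteqP; split => v; rewrite /xsection /= in_setE.
have mf : measurable_fun setT f.
  rewrite [X in measurable_fun _ X](_ : _ = vol_measure R d \o
    xsection ((fun p : measurableTypeR R * rvec R d => row_mx (p.1%:M : 'rV[R]_1) p.2 : rvec R d.+1) @^-1` E)).
    by apply: measurable_fun_xsection; apply: measurable_preimage => //; exact: measurable_row_mx.
  apply/funext => s; congr (vol_measure _ _ _).
  by apply/seteqP; split => v; rewrite /xsection /= in_setE.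
transitivity (\int[lebesgue_measure]_(s in [set: R]) ((r ^+ d)%:E * f (r^-1 * (s - a 0 0))%R))%E.
  apply: eq_integral => s _; rewrite -(IH (rsubmx (a : 'rV_(1 + d)))) //.
  by congr (vol_measure _ _ _); apply/seteqP; split => v; rewrite /= row_mx_affine.
rewrite ge0_integralZl_EFin //; last 2 first.
- by apply: measurableT_comp => //; apply: measurable_funM => //; apply: measurable_funB.
- by rewrite exprn_ge0 // ltW.
by rewrite ge0_integral_affine // muleA -EFinM exprSr.
Qed.

Lemma vol_box (R : realType) d (a : 'rV[R]_d) (e : R) : 0 < e ->
  vol_measure R d [set v : 'rV[R]_d | forall i, `|v 0 i - a 0 i| <= e] = ((e *+ 2) ^+ d)%:E.
Proof.
move=> e0; elim: d a => [|d IH] a.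
  rewrite expr0 /= /dirac indicE mem_set //= => -[] //.
rewrite /= /vol_step.
transitivity (\int[lebesgue_measure]_(s in [set: R])
   (((e *+ 2) ^+ d)%:E * (\1_(`[a 0 0 - e, a 0 0 + e]%classic) s)%:E))%E.
  apply: eq_integral => s _; rewrite indicE.
  case: (boolP (s \in _)) => [/set_mem|sa] /=.
    rewrite in_itv /= -ler_distlC distrC => sa.
    rewrite mule1 -(IH (rsubmx (a : 'rV_(1 + d)))).
    congr (vol_measure _ _ _); apply/seteqP; split => v /= H i.
      by have := H (lift ord0 i); rewrite row_mx_lift rsubmx_lift.
    case: (unliftP ord0 i) => [j|] ->; last by rewrite row_mx_ord0.
    by rewrite row_mx_lift; have := H j; rewrite rsubmx_lift.
  rewrite mule0 (_ : [set _ | _] = set0) ?measure0 //.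
  apply/seteqP; split => // v /= /(_ ord0).
  rewrite row_mx_ord0 => sv; case/negP: sa; apply/mem_set.
  by rewrite /= in_itv /= -ler_distlC distrC.
rewrite ge0_integralZl_EFin //; last 2 first.
- by apply/measurable_EFinP; exact: measurable_indic.
- by rewrite exprn_ge0 // mulrn_wge0 // ltW.
rewrite integral_indic // setIT.
have mI : lebesgue_measure (`[a 0 0 - e, a 0 0 + e]%classic : set (measurableTypeR R)) = (e *+ 2)%:E.
  rewrite lebesgue_measure_itv /= lte_fin ltrD2l gtrN // -EFinB.
  by congr EFin; ring.
by rewrite [X in (_ * X)%E]mI -EFinM exprSr.
Qed.

Lemma vol_hyperplane (R : realType) d (c : 'cV[R]_d) (b : R) : c != 0 ->
  vol_measure R d [set v : 'rV[R]_d | (v *m c) 0 0 = b] = 0%E.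
Proof.
elim: d c b => [|d IH] c b c0; first by case/eqP: c0; exact: flatmx0.
pose c1 : 'cV[R]_(1 + d) := c.
have cE s (v : 'rV_d) : (row_mx (s%:M : 'rV[R]_1) v *m c) 0 0 = s * c 0 0 + (v *m dsubmx c1) 0 0.
  rewrite -[c in LHS](vsubmxK c1) mul_row_col mxE mul_scalar_mx !mxE.
  by congr (_ * c _ _ + _); apply/val_inj.
case: (eqVneq (dsubmx c1) 0) => [d0|d0]; last first.
  rewrite /= /vol_step integral0_eq // => s _.
  rewrite (_ : [set v | _] = [set v : 'rV_d | (v *m dsubmx c1) 0 0 = b - s * c 0 0]); last first.
  by apply/seteqP; split => v /=; rewrite cE; [move=> <-|move=> ->]; ring.
  exact: IH.
have c00 : c 0 0 != 0.
  apply: contraNneq c0 => c00; rewrite -[c](vsubmxK c1) d0.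
  have -> : usubmx c1 = 0.
    by apply/colP => i; rewrite !mxE ord1 -c00; congr (c _ _); apply/val_inj.
  by rewrite col_mx0.
rewrite /= vol_stepE.
pose b0 : measurableTypeR R := b / c 0 0.
rewrite (_ : _ @^-1` _ = [set b0] `*` [set: rvec R d]).
  have l0 : lebesgue_measure ([set b0] : set (measurableTypeR R)) = 0%E.
    exact: lebesgue_measure_set1.
  by rewrite product_measure1E // [X in (X * _)%E]l0 mul0e.
apply/seteqP; split => -[s v] /=; rewrite cE d0 mulmx0 mxE addr0.
  by move=> e; split => //; rewrite /b0 -e mulfK.
by move=> [-> _]; rewrite /b0 divfK.
Qed.

Lemma measurable_linear (R : realType) d (c : 'cV[R]_d) (b e : R) :
  measurable_fun [set: rvec R d] (fun v : rvec R d => b + e * ((v : 'rV_d) *m c) 0 0 : measurableTypeR R).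
Proof.
apply: measurable_funD => //; apply: measurable_funM => //.
rewrite [X in measurable_fun _ X](_ : _ = fun v : rvec R d => \sum_i v ord0 i * c i 0).
  apply: measurable_sum => i; apply: measurable_funM => //; exact: measurable_coord.
by apply/funext => v; rewrite mxE.
Qed.

Lemma eballE (R : realType) d (r : R) (a : 'rV[R]_d) : 0 < r ->
  eball r a = [set y | eball 1 0 (r^-1 *: (y - a))].
Proof.
move=> r0; have E (y : 'rV[R]_d) : \sum_i ((r^-1 *: (y - a)) 0 i - (0 : 'rV[R]_d) 0 i) ^+ 2 =
    r^-1 ^+ 2 * \sum_i (y 0 i - a 0 i) ^+ 2.
  by rewrite mulr_sumr; apply: eq_bigr => i _; rewrite !mxE subr0 exprMn.
apply/seteqP; split => y; rewrite /eball /= E sqrtrM ?sqr_ge0 // sqrtr_sqr.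
  by rewrite gtr0_norm ?invr_gt0 // ler_pdivrMl // mulr1.
by rewrite gtr0_norm ?invr_gt0 // ler_pdivrMl // mulr1.
Qed.

Lemma eball1E (R : realType) d :
  eball 1 (0 : 'rV[R]_d) = [set y | \sum_i (y 0 i) ^+ 2 <= 1].
Proof.
have E (y : 'rV[R]_d) : \sum_i (y 0 i - (0 : 'rV[R]_d) 0 i) ^+ 2 = \sum_i (y 0 i) ^+ 2.
  by apply: eq_bigr => i _; rewrite [X in _ - X]mxE subr0.
have s1 (x : R) : (Num.sqrt x <= 1) = (x <= 1).
  by rewrite -[X in _ <= X](@sqrtr1 R) ler_sqrt ?ltr01 // sqrtr1.
by apply/seteqP; split => y; rewrite /eball /= E s1.
Qed.

Lemma measurable_eball1 (R : realType) d : measurable (eball 1 (0 : 'rV[R]_d) : set (rvec R d)).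
Proof.
rewrite eball1E.
have mf : measurable_fun [set: rvec R d] (fun y : rvec R d => \sum_i (y ord0 i) ^+ 2 : measurableTypeR R).
  by apply: measurable_sum => i; apply: measurable_funX; exact: measurable_coord.
rewrite [X in measurable X](_ : _ = (fun y : rvec R d => \sum_i (y ord0 i) ^+ 2 : measurableTypeR R) @^-1` `]-oo, 1]%classic).
  by apply: measurable_preimage.
by apply/seteqP; split => y /=; rewrite in_itv.
Qed.

Lemma eball1_box (R : realType) d (v : 'rV[R]_d) :
  eball 1 (0 : 'rV[R]_d) v -> forall i, `|v 0 i| <= 1.
Proof.
rewrite eball1E /= => h i; rewrite -(@expr_le1 _ 2) // real_normK ?num_real //.
by apply: le_trans h; rewrite (bigD1 i) //= lerDl sumr_ge0 // => k _; exact: sqr_ge0.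
Qed.

Lemma box_eball1 (R : realType) d (v : 'rV[R]_d) :
  (forall i, `|v 0 i| <= d.+1%:R^-1) -> eball 1 (0 : 'rV[R]_d) v.
Proof.
rewrite eball1E /= => h.
apply: (@le_trans _ _ (\sum_(i < d) d.+1%:R^-1)).
  apply: ler_sum => i _; rewrite -real_normK ?num_real // expr2.
  by rewrite -[leRHS]mulr1 ler_pM // (le_trans (h i)) // invf_le1 ?ltr0n // ler1n.
by rewrite sumr_const card_ord -[_ *+ d]mulr_natl ler_pdivrMr ?ltr0n // mul1r ler_nat leqnSn.
Qed.

Lemma measurable_box (R : realType) d (a : 'rV[R]_d) (e : R) :
  measurable ([set v : 'rV[R]_d | forall i, `|v 0 i - a 0 i| <= e] : set (rvec R d)).
Proof.
rewrite [X in measurable X](_ : _ = \bigcap_(i in [set: 'I_d])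
   (fun y : rvec R d => y ord0 i : measurableTypeR R) @^-1` `[a 0 i - e, a 0 i + e]%classic).
  apply: fin_bigcap_measurable => // i _; apply: measurable_preimage => //.
  exact: measurable_coord.
apply/seteqP; split => y /= H i.
  by move=> _ /=; rewrite in_itv /= -ler_distlC distrC.
by have := H i I; rewrite /= in_itv /= -ler_distlC distrC.
Qed.

Lemma vol_gt0 (R : realType) d (a : 'rV[R]_d) (e : R) (E : set (rvec R d)) :
  0 < e -> measurable E -> (forall v : 'rV[R]_d, (forall i, `|v 0 i - a 0 i| <= e) -> E v) ->
  (0 < vol_measure R d E)%E.
Proof.
move=> e0 mE sE; apply: (@lt_le_trans _ _ ((e *+ 2) ^+ d)%:E).
  by rewrite lte_fin exprn_gt0 // pmulrn_lgt0.
rewrite -(vol_box a e0); apply: le_measure; rewrite ?inE //.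
exact: measurable_box.
Qed.

Lemma vol_eball1_gt0 (R : realType) d : (0 < vol_measure R d (eball 1 (0 : 'rV[R]_d)))%E.
Proof.
apply: (@vol_gt0 _ _ (0 : 'rV_d) d.+1%:R^-1); rewrite ?invr_gt0 ?ltr0n //.
  exact: measurable_eball1.
move=> v h; apply: box_eball1 => i; have := h i; by rewrite mxE subr0.
Qed.

Lemma vol_eball1_fin (R : realType) d : vol_measure R d (eball 1 (0 : 'rV[R]_d)) \is a fin_num.
Proof.
rewrite ge0_fin_numE // (@le_lt_trans _ _ ((1 *+ 2) ^+ d)%:E) ?ltry //.
rewrite -(vol_box (0 : 'rV_d) ltr01); apply: le_measure; rewrite ?inE.
- exact: measurable_eball1.
- exact: measurable_box.
- by move=> v /eball1_box h i; rewrite mxE subr0.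
Qed.

(* On sets of the form [x + r E] the quotient defining the solid angle does not
   depend on [r]. *)
Lemma solid_angle_local (R : realType) d (Q : set 'rV[R]_d) (x : 'rV[R]_d) (r0 : R) (w : \bar R) :
  0 < r0 ->
  (forall r, 0 < r -> r < r0 ->
    measurable ([set u | eball 1 0 u /\ Q (x + r *: u)] : set (rvec R d)) /\
    vol_measure R d [set u | eball 1 0 u /\ Q (x + r *: u)] = w) ->
  solid_angle Q x = fine w / fine (vol_measure R d (eball 1 (0 : 'rV[R]_d))).
Proof.
move=> r00 H; rewrite /solid_angle; apply: lim_near_cst => //.
near=> r.
have rp : 0 < r by near: r; exact: nbhs_right_gt.
have rl : r < r0 by near: r; exact: nbhs_right_lt.
have [mE vE] := H r rp rl.
rewrite !vol_measureE.
have -> : eball r x `&` Q = [set y | [set u | eball 1 0 u /\ Q (x + r *: u)] (r^-1 *: (y - x))].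
  rewrite eballE //; apply/seteqP; split => y /=; rewrite scalerA divff ?gt_eqF // scale1r.
    by rewrite [x + _]addrC subrK.
  by rewrite [x + _]addrC subrK.
rewrite [in X in _ / X]eballE // !vol_affine //; last exact: measurable_eball1.
have rd0 : r ^+ d != 0 by rewrite expf_neq0 // gt_eqF.
rewrite vE fineM ?vol_eball1_fin //; last first.
  rewrite -vE ge0_fin_numE //; apply: (@le_lt_trans _ _ (vol_measure R d (eball 1 0))).
    by apply: le_measure; rewrite ?inE //; [exact: measurable_eball1|move=> u []].
  by rewrite -ge0_fin_numE // vol_eball1_fin.
by rewrite fineM ?vol_eball1_fin //= -mulf_div divff // mul1r.
Unshelve. all: by end_near.
Qed.

(** * Polytopes in homogeneous coordinates *)

Section Hull.
Context {R : realType} {d : nat}.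

(* Homogeneous coordinates: the cone over a polytope [P] meets the hyperplane
   [first coordinate = t] in a copy of [t P]. *)
Definition hat (t : R) (x : 'rV[R]_d) : 'rV[R]_(1 + d) := row_mx t%:M x.

Definition homog n (V : 'M[R]_(n, d)) : 'M[R]_(n, 1 + d) := row_mx (const_mx 1) V.

Definition hull n (V : 'M[R]_(n, d)) : set 'rV[R]_d :=
  [set x | exists2 l : 'rV[R]_n, forall i, 0 <= l 0 i & l *m homog V = hat 1 x].

Lemma row_homog n (V : 'M[R]_(n, d)) i : row i (homog V) = hat 1 (row i V).
Proof.
rewrite /homog /hat row_row_mx; congr row_mx.
by apply/rowP => j; rewrite !mxE ord1 eqxx.
Qed.

Lemma row'_homog n (V : 'M[R]_(n, d)) i : row' i (homog V) = homog (row' i V).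
Proof. by rewrite /homog row'_row_mx; congr row_mx; apply/matrixP => k j; rewrite !mxE. Qed.

Lemma mul_homogE n (V : 'M[R]_(n, d)) (l : 'rV[R]_n) t x :
  l *m homog V = hat t x <-> \sum_i l 0 i = t /\ l *m V = x.
Proof.
rewrite /homog /hat mul_mx_row; split.
  move/eq_row_mx => [/matrixP/(_ 0 0) + ->]; rewrite !mxE eqxx mulr1n => <-; split => //.
  by apply: eq_bigr => i _; rewrite mxE mulr1.
move=> [<- <-]; congr row_mx; apply/matrixP => i j; rewrite !ord1 !mxE eqxx mulr1n.
by apply: eq_bigr => k _; rewrite mxE mulr1.
Qed.

Lemma hatDZ t1 t2 a (x y : 'rV[R]_d) : hat t1 x + a *: hat t2 y = hat (t1 + a * t2) (x + a *: y).
Proof. by rewrite /hat scale_row_mx add_row_mx scale_scalar_mx -raddfD. Qed.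

Lemma hatZ t a (x : 'rV[R]_d) : a *: hat t x = hat (a * t) (a *: x).
Proof. by rewrite /hat scale_row_mx scale_scalar_mx. Qed.

Lemma hat_inj t1 t2 (x y : 'rV[R]_d) : hat t1 x = hat t2 y -> t1 = t2 /\ x = y.
Proof.
by move/eq_row_mx => [/matrixP/(_ 0 0) + ->]; rewrite !mxE eqxx !mulr1n.
Qed.

Lemma hull_row n (V : 'M[R]_(n, d)) i : hull V (row i V).
Proof.
exists (delta_mx 0 i) => [j|]; first by rewrite mxE ler0n.
by rewrite -rowE row_homog.
Qed.

Lemma hull_conv n (V : 'M[R]_(n, d)) x y (t : R) : hull V x -> hull V y ->
  0 <= t -> t <= 1 -> hull V (t *: x + (1 - t) *: y).
Proof.
move=> [l l0 lx] [m m0 my] t0 t1; exists (t *: l + (1 - t) *: m) => [i|].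
  by rewrite mxDZE mxE addr_ge0 ?mulr_ge0 ?subr_ge0.
rewrite mulmxDl -!scalemxAl lx my hatZ hatDZ; congr hat; ring.
Qed.

Lemma hull_sub_convex n (V : 'M[R]_(n, d)) (C : set 'rV[R]_d) :
  @convex_set R 'rV[R]_d C -> (forall i, C (row i V)) -> hull V `<=` C.
Proof.
move=> cC CV x [l l0 /mul_homogE[l1 <-]].
rewrite mulmx_sum_row.
have H (s : seq 'I_n) : 0 < \sum_(i <- s) l 0 i ->
    C ((\sum_(i <- s) l 0 i)^-1 *: \sum_(i <- s) l 0 i *: row i V).
  elim: s => [|j s IH]; first by rewrite big_nil ltxx.
  rewrite !big_cons; set c := \sum_(i <- s) l 0 i; set w := \sum_(i <- s) _ *: _ => cp.
  have c0 : 0 <= c by apply: sumr_ge0.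
  have [cz|cnz] := eqVneq c 0.
    have -> : w = 0.
      rewrite /w big_seq big1 // => i si.
      move/eqP: cz; rewrite /c psumr_eq0 // => /allP/(_ i si)/eqP ->.
      by rewrite scale0r.
    by move: cp; rewrite cz !addr0 => lj; rewrite scalerA mulVf ?gt_eqF // scale1r.
  have cgt : 0 < c by rewrite lt_def cnz.
  have p0 : 0 <= l 0 j / (l 0 j + c) by rewrite divr_ge0 // ltW.
  have p1 : l 0 j / (l 0 j + c) <= 1 by rewrite ler_pdivrMr // mul1r lerDl.
  have := cC _ _ (Itv01 p0 p1) (mem_set (CV j)) (mem_set (IH cgt)).
  have E (a b : R) (v v' : 'rV[R]_d) : b != 0 -> a + b != 0 ->
      (a + b)^-1 *: (a *: v + v') = (a / (a + b)) *: v + (1 - a / (a + b)) *: (b^-1 *: v').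
    move=> b0 ab0; rewrite scalerDr !scalerA; congr (_ *: _ + _ *: _); first by rewrite mulrC.
    by field; rewrite b0.
  by move/set_mem; rewrite E // gt_eqF.
have := H (index_enum _); rewrite l1 invr1 scale1r; exact.
Qed.

Lemma convex_hullE n (V : 'M[R]_(n, d)) : convex_hull [set x | exists i, x = row i V] = hull V.
Proof.
apply/seteqP; split.
  apply: smallest_sub; last by move=> _ [i ->]; exact: hull_row.
  move=> x y t /set_mem hx /set_mem hy; apply/mem_set.
  exact: hull_conv.
move=> x hx C [cC sC]; apply: (hull_sub_convex cC _ hx) => i; apply: sC.
by exists i.
Qed.

Lemma polytope_hull (P : set 'rV[R]_d) : polytope P -> exists n (V : 'M[R]_(n, d)), P = hull V.
Proof.
move=> [S /finite_seqP[s ->] ->]; exists (size s), (\matrix_i nth 0 s i).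
rewrite -convex_hullE; congr convex_hull; apply/seteqP; split => x /=.
  move=> xs; have xi : (index x s < size s)%N by rewrite index_mem.
  by exists (Ordinal xi); rewrite rowK nth_index.
by move=> [i ->]; rewrite rowK mem_nth.
Qed.

Lemma hull_drop n (V : 'M[R]_(n.+1, d)) k (l : 'rV[R]_n.+1) : (forall i, 0 <= l 0 i) ->
  l 0 k = 0 -> l *m homog V = hat 1 (row k V) -> hull V = hull (row' k V).
Proof.
move=> l0 lk lV; apply/seteqP; split => x [m m0 mx].
  pose m' := m + m 0 k *: (l - delta_mx 0 k).
  have m'E i : m' 0 i = m 0 i + m 0 k * (l 0 i - (i == k)%:R).
    by rewrite /m' mxDZE mxBE [delta_mx _ _ _ _]mxE eqxx.
  have m'k : m' 0 k = 0 by rewrite m'E lk eqxx sub0r mulrN1 subrr.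
  exists (col' k m') => [i|].
    rewrite mxE m'E (negPf (_ : lift k i != k)) ?subr0; last by rewrite eq_sym neq_lift.
    by rewrite addr_ge0 // mulr_ge0.
  rewrite -row'_homog -mx.
  transitivity (m' *m homog V); last first.
    by rewrite /m' mulmxDl -scalemxAl mulmxBl lV -rowE row_homog subrr scaler0 addr0.
  apply/rowP => j; rewrite mxE [RHS]mxE (bigD1_ord k) //= m'k mul0r add0r.
  by apply: eq_bigr => i _; congr (_ * _); rewrite [LHS]mxE.
exists (m *m rowsub (lift k) 1%:M) => [i|].
  by rewrite mxE sumr_ge0 // => j _; rewrite mulr_ge0 // !mxE ler0n.
by rewrite -mulmxA mul_rowsub_mx mul1mx -row'Esub row'_homog.
Qed.

Lemma lattice_polytope_hull (P : set 'rV[R]_d) : lattice_polytope P ->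
  exists n (Z : 'M[int]_(n, d)), P = hull (map_mx intr Z).
Proof.
move=> [/polytope_hull PV vP].
pose good n := `[< exists V : 'M[R]_(n, d), P = hull V >].
have exg : exists n, good n.
  by have [n [V PVE]] := PV; exists n; apply/asboolP; exists V.
case: (ex_minnP exg) => n /asboolP[V PE] nmin.
have key k (l : 'rV[R]_n) : (forall i, 0 <= l 0 i) -> l *m homog V = hat 1 (row k V) -> l 0 k = 1.
  move=> l0 lV; case: n V PE nmin k l l0 lV => [|n] V PE nmin k l l0 lV; first by case: (k).
  have [l1 lVE] := (mul_homogE _ _ _ _).1 lV.
  have lk1 : l 0 k <= 1 by rewrite -l1 (bigD1 k) //= lerDl sumr_ge0.
  apply/eqP; rewrite eq_le lk1 leNgt; apply/negP => lk.
  have s0 : 0 < 1 - l 0 k by rewrite subr_gt0.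
  pose m := (1 - l 0 k)^-1 *: (l - l 0 k *: delta_mx 0 k).
  have mE i : m 0 i = (1 - l 0 k)^-1 * (l 0 i - l 0 k * (i == k)%:R).
    by rewrite /m mxE mxBE [(_ *: delta_mx _ _) _ _]mxE [delta_mx _ _ _ _]mxE eqxx.
  have : hull V = hull (row' k V).
    apply: (@hull_drop _ _ _ m).
    - move=> i; rewrite mE mulr_ge0 ?invr_ge0 ?(ltW s0) //.
      by case: eqVneq => [->|_]; rewrite ?mulr1 ?subrr // mulr0 subr0.
    - by rewrite mE eqxx mulr1 subrr mulr0.
    - rewrite /m -scalemxAl mulmxBl -scalemxAl -rowE lV row_homog -{1}[hat 1 _]scale1r -scalerBl.
      by rewrite scalerA mulVf ?gt_eqF // scale1r.
  rewrite -PE => PE'; have : good n by apply/asboolP; exists (row' k V).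
  by move/nmin; rewrite ltnn.
have vert k : vertex P (row k V).
  rewrite PE; split; first exact: hull_row.
  move=> y z t [l l0 ly] [m m0 mz] t0 t1 vE.
  have lm : (t *: l + (1 - t) *: m) 0 k = 1.
    apply: key => [i|].
      by rewrite mxDZE mxE addr_ge0 // mulr_ge0 // ?subr_ge0 ltW.
    rewrite mulmxDl -!scalemxAl ly mz hatZ hatDZ -vE; congr hat; ring.
  have le1 (q : 'rV[R]_n) w : (forall i, 0 <= q 0 i) -> q *m homog V = hat 1 w -> q 0 k <= 1.
    move=> q0 /mul_homogE[q1 _].
    by rewrite -q1 (bigD1 k) //= lerDl sumr_ge0.
  have eq1 (q : 'rV[R]_n) w : (forall i, 0 <= q 0 i) -> q *m homog V = hat 1 w -> q 0 k = 1 -> w = row k V.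
    move=> q0 qw qk; suff qE : q = delta_mx 0 k.
      by move: qw; rewrite qE -rowE row_homog => /hat_inj[].
    have [q1 _] := (mul_homogE _ _ _ _).1 qw.
    apply/rowP => i; rewrite mxE eqxx /=; case: eqVneq => [->//|ik].
    apply/eqP; rewrite eq_le q0 andbT -(lerD2l 1) addr0 -{1}qk -q1.
    by rewrite (bigD1 k) //= lerD2l (bigD1 i) //= lerDl sumr_ge0.
  have l1 := le1 _ _ l0 ly; have m1 := le1 _ _ m0 mz.
  move: lm; rewrite mxDZE mxE => lm.
  by split; [apply: (eq1 _ _ l0 ly)|apply: (eq1 _ _ m0 mz)]; nra.
have lat k : exists z : 'rV[int]_d, row k V = map_mx intr z.
  by have [z _ <-] := vP _ (vert k); exists z.
pose z k := projT1 (cid (lat k)).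
exists n, (\matrix_k z k); rewrite PE; congr hull; apply/row_matrixP => k.
by rewrite -map_row rowK (projT2 (cid (lat k))).
Qed.

Lemma row_full_homog n (V : 'M[R]_(n, d)) : has_dim (hull V) d -> row_full (homog V).
Proof.
move=> [[x0 hx0] [U dU HU]].
have hat0 x (c : 'cV[R]_(1 + d)) : hull V x -> homog V *m c = 0 -> hat 1 x *m c = 0.
  by move=> [l _ <-] Vc; rewrite -mulmxA Vc mulmx0.
rewrite -cokermx_eq0; apply/eqP/matrixP => i0 j; rewrite [RHS]mxE.
pose c := col j (cokermx (homog V)).
have Vc : homog V *m c = 0 by rewrite /c colE mulmxA mulmx_coker mul0mx.
suff /colP/(_ i0) : c = 0 by rewrite !mxE.
pose K := lker (linfun (mulmxr (dsubmx c)) : 'Hom('rV[R]_d, 'rV[R]_1)).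
have hatc t x : hat t x *m c = (t * usubmx c 0 0)%:M + x *m dsubmx c.
  by rewrite -{1}[c]vsubmxK mul_row_col mul_scalar_mx {1}[usubmx c]mx11_scalar scale_scalar_mx.
have UK : (U <= K)%VS.
  apply/HU => x y hx hy; rewrite memv_ker lfunE /=.
  have := hat0 _ _ hx Vc; have := hat0 _ _ hy Vc; rewrite !hatc => e1 e2.
  by rewrite mulmxBl subr_eq0; apply/eqP; move: e1; rewrite -e2 => /addrI.
have d0 : dsubmx c = 0.
  have UT : U = fullv by apply/eqP; rewrite eqEdim subvf dimvf /= dU /dim /= mul1n.
  apply/row_matrixP => i; rewrite rowE row0.
  have : delta_mx 0 i \in K by apply: (subvP UK); rewrite UT memvf.
  by rewrite memv_ker lfunE /= => /eqP.
have := hat0 _ _ hx0 Vc; rewrite hatc d0 mulmx0 addr0 mul1r => /matrixP/(_ 0 0).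
rewrite !mxE eqxx mulr1n => u0.
rewrite -[c]vsubmxK d0 -[RHS]col_mx0; congr col_mx.
by apply/matrixP => p q; rewrite !ord1 [RHS]mxE -u0 !mxE.
Qed.

End Hull.

(** * Solid angles *)

Lemma ex_pos_lower_bound (R : realFieldType) (T : finType) (f : T -> R) :
  (forall x, 0 < f x) -> exists2 e, 0 < e & forall x, e <= f x.
Proof.
move=> f0; suff [e e0 H] : exists2 e, 0 < e & forall x, x \in enum T -> e <= f x.
  by exists e => // x; apply: H; rewrite mem_enum.
elim: (enum T) => [|y s [e e0 H]]; first by exists 1.
exists (Num.min e (f y)); first by rewrite lt_min e0 f0.
move=> x; rewrite inE ge_min => /orP[/eqP->|xs]; first by rewrite lexx orbT.
by rewrite H.
Qed.

Section LocalStructure.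
Context {R : realType} {d n : nat}.
Hypothesis d0 : (0 < d)%N.
Variables (V : 'M[R]_(n, d)) (h : 'cV[R]_n).
Hypotheses (fullV : row_full (homog V)) (genh : generic_height (homog V) h).

Local Notation W := (homog V).
Local Notation C := (basis_coord W).
Local Notation basis S := (is_basis W S (C S)).
Local Notation vol := (vol_measure R d).
Local Notation ball := (eball 1 (0 : 'rV[R]_d)).

Definition bary S (y : 'rV[R]_(1 + d)) i : R := (y *m C S) 0 i.

(* The regular triangulation of the polytope induced by the heights [h]. *)
Definition cells : {set {set 'I_n}} :=
  [set S | `[< lower_basis W h S (C S) >]].

(* Directions pointing out of the facets in [I] of the simplex [S] and into its
   other facets; facets are labelled by the opposite vertex. *)
Definition directions (S I : {set 'I_n}) : set 'rV[R]_d :=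
  [set u | ball u /\ forall i, i \in S ->
    if i \in I then bary S (hat 0 u) i < 0 else 0 < bary S (hat 0 u) i].

Definition in_halfopen (S I : {set 'I_n}) (y : 'rV[R]_(1 + d)) : bool :=
  [forall i in S, if i \in I then 0 < bary S y i else 0 <= bary S y i].

Definition direction_prob (S I : {set 'I_n}) : R :=
  fine (vol (directions S I)) / fine (vol ball).

Lemma basisP S C' : is_basis W S C' -> C' = C S /\ basis S.
Proof. by move=> b; have e := basis_coordP b; rewrite e. Qed.

Lemma cellsP S : S \in cells -> lower_basis W h S (C S).
Proof. by rewrite inE => /asboolP. Qed.

Lemma cells_basis S : S \in cells -> basis S.
Proof. by move/cellsP => []. Qed.

Lemma baryDZ S t x r u i :
  bary S (hat t (x + r *: u)) i = bary S (hat t x) i + r * bary S (hat 0 u) i.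
Proof.
rewrite /bary (_ : hat t (x + r *: u) = hat t x + r *: hat 0 u); last first.
  by rewrite hatDZ mulr0 addr0.
by rewrite mulmxDl -scalemxAl mxDZE.
Qed.

Lemma bary0E S u i : bary S (hat 0 u) i = (u *m col i (dsubmx (C S))) 0 0.
Proof.
rewrite /bary -[C S in LHS](@vsubmxK _ 1 d) /hat mul_row_col mul_scalar_mx scale0r add0r.
by rewrite !mxE; apply: eq_bigr => j _; rewrite !mxE.
Qed.

Lemma sum_bary S t x : basis S -> \sum_(i in S) bary S (hat t x) i = t.
Proof.
move=> b; have [e _] := (mul_homogE _ _ _ _).1 (is_basis_mulK (hat t x) b).
transitivity (\sum_i (hat t x *m C S) 0 i) => //.
rewrite [RHS](bigID (mem S)) /= [X in _ = _ + X]big1 ?addr0 // => i iS.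
exact: is_basis_out b iS.
Qed.

Lemma card_basis S : basis S -> #|S| = d.+1.
Proof. exact: is_basis_card. Qed.

Lemma bary_vertex S i k : basis S -> k \in S -> bary S (row k W) i = (i == k)%:R.
Proof. by move=> [_ bS _] kS; rewrite /bary bS // mxE eqxx. Qed.

Definition bary_bound S i : R := 1 + \sum_(j < d) `|dsubmx (C S) j i|.

Lemma bary_bound_gt0 S i : 0 < bary_bound S i.
Proof. by rewrite ltr_wpDr // sumr_ge0. Qed.

Lemma bary_lt S i (u : 'rV[R]_d) (e : R) : 0 < e -> (forall j, `|u 0 j| <= e) ->
  `|bary S (hat 0 u) i| < e * bary_bound S i.
Proof.
move=> e0 ue; rewrite bary0E mxE (le_lt_trans (ler_norm_sum _ _ _)) //.
rewrite /bary_bound mulrDr mulr1 mulr_sumr ltr_pwDl // ler_sum // => j _.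
by rewrite normrM [col _ _ _ _]mxE ler_wpM2r.
Qed.

Lemma col_neq0 S i : basis S -> i \in S -> col i (dsubmx (C S)) != 0.
Proof.
move=> b iS; have [k kS ki] : exists2 k, k \in S & k != i.
  have : (0 < #|S :\ i|)%N.
    by have := cardsD1 i S; rewrite iS (card_basis b) add1n => -[<-].
  by case/card_gt0P => k; rewrite !inE => /andP[ki kS]; exists k.
apply: contraTneq isT => c0.
have : bary S (hat 0 (row i V - row k V)) i = 0 by rewrite bary0E c0 mulmx0 mxE.
have -> : hat 0 (row i V - row k V) = row i W + (-1) *: row k W.
  by rewrite !row_homog hatDZ scaleN1r mulN1r subrr.
rewrite /bary mulmxDl -scalemxAl mxDZE -/(bary S (row i W) i) -/(bary S (row k W) i).
rewrite !bary_vertex // eqxx eq_sym (negPf ki) mulr0 addr0.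
by move/eqP; rewrite oner_eq0.
Qed.

Lemma dilate_hullP (t : nat) y : (0 < t)%N ->
  dilate t (hull V) y <-> exists S, basis S /\ forall i, 0 <= bary S (hat t%:R y) i.
Proof.
move=> t0; have tp : 0 < t%:R :> R by rewrite ltr0n.
split=> [[x [l l0 lx] <-]|[S [b c0]]].
  have tl0 i : 0 <= (t%:R *: l) 0 i by rewrite mxE mulr_ge0 // ltW.
  have [S [C' [b H]]] := caratheodory fullV tl0.
  have [e b'] := basisP b; exists S; split => // i.
  by have := H i; rewrite -scalemxAl lx hatZ mulr1 e.
exists (t%:R^-1 *: y); last by rewrite scalerA divff ?gt_eqF // scale1r.
exists (t%:R^-1 *: (hat t%:R y *m C S)) => [i|].
  by rewrite mxE mulr_ge0 // ?invr_ge0 ?(ltW tp) //; exact: c0.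
by rewrite -scalemxAl (is_basis_mulK _ b) hatZ mulVf ?gt_eqF.
Qed.

Lemma measurable_bary_hat S i t x r :
  measurable_fun [set: rvec R d]
    (fun u : rvec R d => bary S (hat t (x + r *: (u : 'rV_d))) i : measurableTypeR R).
Proof.
rewrite [X in measurable_fun _ X](_ : _ = fun u : rvec R d =>
  bary S (hat t x) i + r * ((u : 'rV_d) *m col i (dsubmx (C S))) 0 0).
  exact: measurable_linear.
by apply/funext => u; rewrite baryDZ bary0E.
Qed.

Lemma measurable_dilate (t : nat) x r : (0 < t)%N ->
  measurable ([set u | ball u /\ dilate t (hull V) (x + r *: u)] : set (rvec R d)).
Proof.
move=> t0; rewrite [X in measurable X](_ : _ = ball `&`
  \bigcup_(S in [set S | basis S]) \bigcap_(i in [set: 'I_n])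
    ((fun u : rvec R d => bary S (hat t%:R (x + r *: (u : 'rV_d))) i : measurableTypeR R) @^-1` `[0, +oo[%classic)).
  apply: measurableI; first exact: measurable_eball1.
  apply: fin_bigcup_measurable => [|S bS]; first exact: finite_finset.
  apply: fin_bigcap_measurable => // i _.
  apply: measurable_preimage => //; exact: measurable_bary_hat.
apply/seteqP; split => u /= [bu].
  move/(dilate_hullP _ t0) => [S [b H]]; split => //; exists S => // i _.
  by rewrite /= in_itv /= H.
move=> [S b H]; split => //; apply/(dilate_hullP _ t0); exists S; split => // i.
by have := H i I; rewrite /= in_itv /= andbT.
Qed.

Lemma measurable_directions S I : measurable (directions S I : set (rvec R d)).
Proof.
pose J i : set R := if i \in I then `]-oo, 0[%classic else `]0, +oo[%classic.
rewrite [X in measurable X](_ : _ = ball `&` \bigcap_(i in [set` S])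
    ((fun u : rvec R d => bary S (hat 0 (0 + 1 *: (u : 'rV_d))) i : measurableTypeR R) @^-1` J i)).
  apply: measurableI; first exact: measurable_eball1.
  apply: fin_bigcap_measurable => // i _.
  apply: measurable_preimage; first exact: measurable_bary_hat.
  by rewrite /J; case: ifP.
apply/seteqP; split => u /= [bu H]; split => // i iS.
  by have := H i iS; rewrite /= add0r scale1r /J; case: ifP; rewrite /= in_itv /= ?andbT.
by have := H i iS; rewrite /= add0r scale1r /J; case: ifP; rewrite /= in_itv /= ?andbT.
Qed.

Definition degenerate : set (rvec R d) :=
  [set u | exists S i, [/\ basis S, i \in S & bary S (hat 0 (u : 'rV_d)) i = 0]].

Lemma negligible_bigsetU (T : Type) (s : seq T) (F : T -> set (rvec R d)) (P : pred T) :
  (forall x, P x -> vol.-negligible (F x)) -> vol.-negligible (\big[setU/set0]_(x <- s | P x) F x).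
Proof.
move=> H; elim/big_ind : _ => //; first exact: negligible_set0.
by move=> A B; exact: negligibleU.
Qed.

Lemma negligible_degenerate : vol.-negligible degenerate.
Proof.
have sub : degenerate `<=` \big[setU/set0]_(Si : {set 'I_n} * 'I_n | `[< basis Si.1 >] && (Si.2 \in Si.1))
    [set u : 'rV[R]_d | (u *m col Si.2 (dsubmx (C Si.1))) 0 0 = 0].
  move=> u [S [i [b iS e]]]; rewrite -bigcup_seq_cond.
  exists (S, i); last by rewrite /= -bary0E.
  by rewrite /= mem_index_enum iS andbT; apply/asboolP.
apply: (negligibleS sub).
apply: negligible_bigsetU => -[S i] /= /andP[/asboolP b iS].
apply/negligibleP; last exact: (vol_hyperplane _ (col_neq0 b iS)).
rewrite [X in measurable X](_ : _ = (fun u : rvec R d => 0 + 1 * ((u : 'rV_d) *m col i (dsubmx (C S))) 0 0 : measurableTypeR R) @^-1` [set 0]).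
  apply: measurable_preimage => //; exact: measurable_linear.
by apply/seteqP; split => u /=; rewrite add0r mul1r.
Qed.

Lemma ex_small_radius t x : exists2 r0, 0 < r0 & forall r u S i, 0 < r -> r < r0 ->
  ball u -> bary S (hat t x) i != 0 ->
  `|r * bary S (hat 0 u) i| < `|bary S (hat t x) i|.
Proof.
pose f (Si : {set 'I_n} * 'I_n) := if bary Si.1 (hat t x) Si.2 == 0 then 1 else
  `|bary Si.1 (hat t x) Si.2| / bary_bound Si.1 Si.2.
have [Si|r0 r00 H] := @ex_pos_lower_bound R _ f.
  by rewrite /f; case: eqVneq => // c0; rewrite divr_gt0 ?normr_gt0 ?bary_bound_gt0.
exists r0 => // r u S i rp rl bu c0.
have := H (S, i); rewrite /f /= (negPf c0) ler_pdivlMr ?bary_bound_gt0 // => H1.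
apply: lt_le_trans H1; rewrite normrM gtr0_norm //.
apply: lt_trans (_ : r * bary_bound S i < _); last by rewrite ltr_pM2r ?bary_bound_gt0.
rewrite ltr_pM2l //.
by have := @bary_lt S i u 1 ltr01 (eball1_box bu); rewrite mul1r.
Qed.

Lemma sign_perturb (l g : R) : (l != 0 -> `|g| < `|l|) -> 0 < l + g -> 0 <= l.
Proof.
move=> H lg; rewrite leNgt; apply/negP => l0.
have := H (negbT (lt_eqF l0)); rewrite (ltr0_norm l0) ltr_norml; lra.
Qed.

Lemma halfopen_directions S I t x r u :
  (forall i, bary S (hat t x) i != 0 ->
    `|r * bary S (hat 0 u) i| < `|bary S (hat t x) i|) -> 0 < r ->
  directions S I u -> in_halfopen S I (hat t x) ->
  forall i, i \in S -> 0 < bary S (hat t (x + r *: u)) i.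
Proof.
move=> H rp [_ D] /forall_inP K i iS; rewrite baryDZ.
have := D i iS; have := K i iS; case: ifP => _ l g.
  by have := H i (negbT (gt_eqF l)); rewrite (gtr0_norm l) ltr_norml; lra.
by rewrite ltr_wpDl // mulr_gt0.
Qed.

Definition faces (y : 'rV[R]_(1 + d)) : {set {set 'I_n} * {set 'I_n}} :=
  [set J : {set 'I_n} * {set 'I_n} | [&& J.1 \in cells, J.2 \subset J.1 & in_halfopen J.1 J.2 y]].

Lemma dilate_directions (t : nat) x r u : (0 < t)%N -> 0 < r ->
  (forall S i, bary S (hat t%:R x) i != 0 ->
    `|r * bary S (hat 0 u) i| < `|bary S (hat t%:R x) i|) ->
  ball u -> ~ degenerate u ->
  dilate t (hull V) (x + r *: u) ->
    exists2 J, J \in faces (hat t%:R x) & directions J.1 J.2 u.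
Proof.
move=> t0 rp H bu ndeg.
move/(dilate_hullP _ t0) => [S0 [b0 c0]].
have gen S C' i : is_basis W S C' -> i \in S -> (hat t%:R (x + r *: u) *m C') 0 i != 0.
  move=> b' iS; have [-> b] := basisP b'.
  rewrite -[X in X != 0]/(bary S _ i) baryDZ.
  have g0 : bary S (hat 0 u) i != 0.
    by apply/eqP => g0; apply: ndeg; exists S, i.
  have [->|l0] := eqVneq (bary S (hat t%:R x) i) 0.
    by rewrite add0r mulf_neq0 // gt_eqF.
  by apply: contraTneq (H S i l0) => /eqP; rewrite addr_eq0 => /eqP ->; rewrite normrN ltxx.
have [S [C' [lb c]]] : exists S C', lower_basis W h S C' /\ forall i, 0 <= (hat t%:R (x + r *: u) *m C') 0 i.
  apply: (@ex_lower_basis _ _ _ W h _ (col_mx 1%:M 0)) => //; last by exists S0, (C S0).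
  by rewrite /homog mul_row_col mulmx1 mulmx0 addr0.
have [e b] := basisP lb.1; rewrite {C'}e in lb c.
have pos i : i \in S -> 0 < bary S (hat t%:R x) i + r * bary S (hat 0 u) i.
  move=> iS; rewrite -baryDZ lt_def; apply/andP; split; first exact: gen b iS.
  exact: c.
have g0 i : i \in S -> bary S (hat 0 u) i != 0.
  by move=> iS; apply/eqP => g0; apply: ndeg; exists S, i.
exists (S, [set i in S | bary S (hat 0 u) i < 0]) => /=.
  rewrite !inE /=; apply/and3P; split; first exact/asboolP.
    by apply/fintype.subsetP => i; rewrite inE => /andP[].
  apply/forall_inP => i iS; rewrite inE iS /=; have := pos i iS; case: ifP => gi p.
    have : r * bary S (hat 0 u) i < 0 by rewrite pmulr_rlt0.
    by lra.
  by apply: sign_perturb p; exact: H.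
split => // i iS; rewrite inE iS /=; case: ifP => // /negbT.
by rewrite -leNgt le_eqVlt eq_sym (negPf (g0 i iS)).
Qed.

Lemma directions_dilate (t : nat) x r u J : (0 < t)%N -> 0 < r ->
  (forall S i, bary S (hat t%:R x) i != 0 ->
    `|r * bary S (hat 0 u) i| < `|bary S (hat t%:R x) i|) ->
  J \in faces (hat t%:R x) -> directions J.1 J.2 u ->
  dilate t (hull V) (x + r *: u).
Proof.
case: J => S I t0 rp H; rewrite inE /= => /and3P[SC _ K] D.
apply/(dilate_hullP _ t0); exists S; split; first exact: cells_basis.
move=> i; case: (boolP (i \in S)) => iS.
  by apply/ltW/(halfopen_directions _ rp D K iS); exact: H.
by rewrite /bary (is_basis_out _ (cells_basis SC) iS).
Qed.

Lemma trivIset_directions (t : nat) x r0 :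
  0 < r0 -> (forall r u S i, 0 < r -> r < r0 ->
  ball u -> bary S (hat t%:R x) i != 0 ->
  `|r * bary S (hat 0 u) i| < `|bary S (hat t%:R x) i|) ->
  trivIset [set` faces (hat t%:R x)] (fun J => directions J.1 J.2).
Proof.
move=> r00 H; apply/trivIsetP => -[S I] [S' I'] /=.
rewrite !inE /= => /and3P[SC IS K] /and3P[SC' IS' K'] /eqP ne.
apply/seteqP; split => // u [D D']; apply: ne.
have [bu _] := D.
have rp : 0 < r0 / 2 by rewrite divr_gt0.
have rl : r0 / 2 < r0 by rewrite ltr_pdivrMr // mulr_natr mulr2n ltrDl.
have SS : S = S'.
  have p := halfopen_directions (fun i => H _ u S i rp rl bu) rp D K.
  have p' := halfopen_directions (fun i => H _ u S' i rp rl bu) rp D' K'.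
  exact: (lower_basis_unique (asboolW SC) (asboolW SC') p p').
subst S'; congr pair; apply/setP => i.
case: (boolP (i \in S)) => iS.
  have [_ /(_ i iS)] := D; have [_ /(_ i iS)] := D'.
  by do 2 case: ifP => // _; lra.
have := contra (fintype.subsetP IS i) iS; have := contra (fintype.subsetP IS' i) iS.
by move=> /negPf -> /negPf ->.
Qed.

Lemma vol_directions_fin S I : vol (directions S I) \is a fin_num.
Proof.
rewrite ge0_fin_numE // (@le_lt_trans _ _ (vol ball)) //; last first.
  by rewrite -ge0_fin_numE // vol_eball1_fin.
apply: le_measure; rewrite ?inE; last by move=> u [].
  exact: measurable_directions.
exact: measurable_eball1.
Qed.

Lemma solid_angle_dilate (t : nat) x : (0 < t)%N ->
  solid_angle (dilate t (hull V)) x =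
  \sum_(J : {set 'I_n} * {set 'I_n} | (J.1 \in cells) && (J.2 \subset J.1))
     direction_prob J.1 J.2 * (in_halfopen J.1 J.2 (hat t%:R x))%:R.
Proof.
move=> t0; have [r0 r00 H] := ex_small_radius t%:R x.
rewrite (@solid_angle_local _ _ _ _ r0 (\sum_(J in faces (hat t%:R x)) vol (directions J.1 J.2))%E) //; last first.
  move=> r rp rl; split; first exact: measurable_dilate.
  set E := [set u | _].
  pose U := \bigcup_(J in [set` faces (hat t%:R x)]) directions J.1 J.2.
  have mU : measurable (U : set (rvec R d)).
    by apply: fin_bigcup_measurable => // J _; exact: measurable_directions.
  have UE : U `<=` E.
    move=> u [J JF D]; have [bu _] := D; split => //.
    exact: directions_dilate (fun S i => H r u S i rp rl bu) JF D.
  have mE : measurable (E : set (rvec R d)) by exact: measurable_dilate.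
  have ED : vol (E `\` U) = 0%E.
    apply/negligibleP; first exact: measurableD.
    apply: negligibleS negligible_degenerate => u [[bu Du] nU].
    apply: contrapT => ndeg; apply: nU.
    have := @dilate_directions t x r u t0 rp (fun S i => H r u S i rp rl bu) bu ndeg.
    by move=> /(_ Du)[J JF D]; exists J.
  have -> : E = U `|` (E `\` U) by rewrite setDUK.
  rewrite measureU0 //; last exact: measurableD.
  rewrite /U measure_fin_bigcup //; last 2 first.
  - exact: trivIset_directions r00 H.
  - by move=> J _; exact: measurable_directions.
  rewrite (fsbigE (enum (faces (hat t%:R x)))) ?enum_uniq //.
  - by rewrite big_enum_cond /=; apply: eq_bigl => J; rewrite mem_setE andbb.
  - by move=> J /=; rewrite mem_enum.
  - by move=> J /=; rewrite mem_enum => ->.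
rewrite -sum_fine; last by move=> J _; exact: vol_directions_fin.
rewrite mulr_suml big_mkcond [RHS]big_mkcond; apply: eq_bigr => J _.
rewrite inE -/(direction_prob _ _) andbA; case: (_ && (_ \subset _)) => //=.
by case: in_halfopen; rewrite ?mulr1 ?mulr0.
Qed.

Lemma direction_prob_ge0 S I : 0 <= direction_prob S I.
Proof. by rewrite divr_ge0 // fine_ge0. Qed.

Lemma direction_prob_set0 S : basis S -> direction_prob S finset.set0 = 0.
Proof.
move=> b; rewrite /direction_prob (_ : directions S _ = set0) ?measure0 ?mul0r //.
apply/seteqP; split => // u [_ H]; have := sum_bary 0 u b; apply/eqP.
have [i iS] : exists i, i \in S by apply/card_gt0P; rewrite card_basis.
rewrite gt_eqF // (bigD1 i) //= ltr_pwDl //.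
  by have := H i iS; rewrite inE.
by apply: sumr_ge0 => k /andP[kS _]; have := H k kS; rewrite inE => /ltW.
Qed.

Lemma direction_prob_id S : basis S -> direction_prob S S = 0.
Proof.
move=> b; rewrite /direction_prob (_ : directions S _ = set0) ?measure0 ?mul0r //.
apply/seteqP; split => // u [_ H]; have := sum_bary 0 u b; apply/eqP.
have [i iS] : exists i, i \in S by apply/card_gt0P; rewrite card_basis.
rewrite lt_eqF // (bigD1 i) //= ltr_nwDl //.
  by have := H i iS; rewrite iS.
by apply: sumr_le0 => k /andP[kS _]; have := H k kS; rewrite kS => /ltW.
Qed.

Lemma direction_prob_gt0 S (I : {set 'I_n}) : basis S -> I \subset S ->
  (0 < #|I|)%N -> (#|I| < #|S|)%N -> 0 < direction_prob S I.
Proof.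
move=> b IS I0 IS1.
have nI : 0 < #|I|%:R :> R by rewrite ltr0n.
have nJ : 0 < #|S :\: I|%:R :> R by rewrite ltr0n cardsD (finset.setIidPr IS) subn_gt0.
have pI : 0 < #|I|%:R^-1 :> R by rewrite invr_gt0.
have pJ : 0 < #|S :\: I|%:R^-1 :> R by rewrite invr_gt0.
pose c : 'rV[R]_n := \row_i (if i \in I then - #|I|%:R^-1 else if i \in S then #|S :\: I|%:R^-1 else 0).
have csum : \sum_i c 0 i = 0.
  rewrite (bigID (mem I)) /= (eq_bigr (fun=> - #|I|%:R^-1)); last first.
    by move=> i iI; rewrite mxE iI.
  rewrite [X in _ + X](eq_bigr (fun i => if i \in S :\: I then #|S :\: I|%:R^-1 else 0)); last first.
    by move=> i iI; rewrite mxE (negPf iI) inE iI.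
  rewrite -big_mkcondr (eq_bigl (mem (S :\: I))); last first.
    by move=> i; rewrite !inE; case: (i \in I).
  rewrite !sumr_const -[X in X + _]mulr_natr -[X in _ + X]mulr_natr mulNr.
  by rewrite !mulVf ?gt_eqF // addNr.
pose u0 : 'rV[R]_d := c *m V.
have cW : c *m W = hat 0 u0 by apply/mul_homogE.
have cout i : i \notin S -> c 0 i = 0.
  move=> iS; rewrite mxE (negPf iS) (negPf (contra (fintype.subsetP IS i) iS)) //.
have cC i : bary S (hat 0 u0) i = c 0 i.
  by rewrite /bary -cW (is_basis_unique b).
have cn i : i \in S -> c 0 i != 0.
  move=> iS; rewrite mxE iS; case: ifP => _; first by rewrite oppr_eq0 invr_eq0 gt_eqF.
  by rewrite invr_eq0 gt_eqF.
pose D : R := d.+1%:R^-1 / 2.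
have D0 : 0 < D by rewrite divr_gt0 ?invr_gt0 ?ltr0n.
have [j|s s0 sb] := @ex_pos_lower_bound R 'I_d (fun j => D / (1 + `|u0 0 j|)).
  by rewrite divr_gt0 // ltr_pwDl.
have [i|e1 e10 e1b] := @ex_pos_lower_bound R 'I_n
  (fun i => if i \in S then s * `|c 0 i| / bary_bound S i else 1).
  by case: ifP => // iS; rewrite divr_gt0 ?bary_bound_gt0 // mulr_gt0 // normr_gt0 cn.
pose e := Num.min e1 D.
have e0 : 0 < e by rewrite lt_min e10.
rewrite /direction_prob divr_gt0 // fine_gt0 //; last first.
  by rewrite vol_eball1_gt0 -ge0_fin_numE // vol_eball1_fin.
rewrite -[X in _ && X]ge0_fin_numE // vol_directions_fin andbT.
apply: (@vol_gt0 _ _ (s *: u0) e) => //; first exact: measurable_directions.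
move=> v ve; split.
  apply: box_eball1 => j; rewrite -[v](subrK (s *: u0)) mxE.
  apply: le_trans (ler_normD _ _) _.
  have := ve j; rewrite mxBE => h1.
  have h2 : `|(s *: u0) 0 j| <= D.
    rewrite mxE normrM gtr0_norm //; have := sb j; rewrite ler_pdivlMr ?ltr_pwDl // => h2.
    by apply: le_trans h2; rewrite ler_pM2l // lerDr.
  have h3 : e <= D by rewrite /e ge_min lexx orbT.
  have h4 : d.+1%:R^-1 = D + D by exact: splitr.
  by rewrite h4 lerD // (le_trans h1).
move=> i iS.
have gE : bary S (hat 0 v) i = s * c 0 i + bary S (hat 0 (v - s *: u0)) i.
  by rewrite -{1}[v](subrK (s *: u0)) baryDZ cC addrC.
have gb : `|bary S (hat 0 (v - s *: u0)) i| < s * `|c 0 i|.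
  have : `|bary S (hat 0 (v - s *: u0)) i| < e * bary_bound S i.
    apply: bary_lt => // j; have := ve j; by rewrite mxBE.
  move=> /lt_le_trans; apply; rewrite -ler_pdivlMr ?bary_bound_gt0 //.
  by have := e1b i; rewrite iS /e; apply: le_trans; rewrite ge_min lexx.
rewrite gE.
move: gb; rewrite [c 0 i]mxE iS; case: ifP => _.
  by rewrite normrN (gtr0_norm pI) ltr_norml; lra.
by rewrite (gtr0_norm pJ) ltr_norml; lra.
Qed.

Lemma ex_nondegenerate : exists u : 'rV[R]_d, ball u /\ ~ degenerate u.
Proof.
apply: contrapT => H.
have /(negligibleP _ (@measurable_eball1 R d)) : vol.-negligible ball.
  apply: negligibleS negligible_degenerate => u bu.
  by apply: contrapT => nu; apply: H; exists u.
by move=> e; have := vol_eball1_gt0 R d; rewrite e ltxx.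
Qed.

Lemma cells_neq0 : exists S, S \in cells.
Proof.
have [S [C0 b0']] := ex_is_basis fullV; have [_ b] := basisP b0'.
pose c : 'rV[R]_n := \row_i (if i \in S then d.+1%:R^-1 else 0).
have csum : \sum_i c 0 i = 1.
  rewrite (eq_bigr (fun i => if i \in S then d.+1%:R^-1 else 0)); last by move=> i _; rewrite mxE.
  by rewrite -big_mkcond /= sumr_const card_basis // -[_ *+ d.+1]mulr_natl divff // pnatr_eq0.
pose x : 'rV[R]_d := c *m V.
have cW : c *m W = hat 1 x by apply/mul_homogE.
have cC i : bary S (hat 1 x) i = c 0 i.
  by rewrite /bary -cW (is_basis_unique b) // => k kS; rewrite mxE (negPf kS).
have [u [bu ndeg]] := ex_nondegenerate.
have [r0 r00 H] := ex_small_radius 1%:R x.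
have rp : 0 < r0 / 2 by rewrite divr_gt0.
have rl : r0 / 2 < r0 by rewrite ltr_pdivrMr // mulr_natr mulr2n ltrDl.
have := @dilate_directions 1 x (r0 / 2) u isT rp (fun S i => H _ u S i rp rl bu) bu ndeg.
case=> [|[S' I]]; last by rewrite inE => /and3P[SC _ _] _; exists S'.
apply/dilate_hullP => //; exists S; split => // i.
case: (boolP (i \in S)) => iS; last by rewrite /bary (is_basis_out _ b iS).
have := H _ u S i rp rl bu; rewrite baryDZ cC mxE iS.
have p0 : 0 < d.+1%:R^-1 :> R by rewrite invr_gt0 ltr0n.
rewrite (gt_eqF p0) (gtr0_norm p0) => /(_ isT); rewrite ltr_norml => /andP[h1 _].
by rewrite -lerBlDl sub0r ltW.
Qed.

End LocalStructure.

(** * Lattice points *)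

Definition finsupp_fun (T : Type) (R : nmodType) (f : T -> R) : Prop :=
  finite_set [set x | f x != 0].

Section FiniteSupport.
Context {T : choiceType} {R : nmodType}.
Implicit Types f g : T -> R.

Lemma fsum_on (A : {fset T}) f : (forall x, f x != 0 -> x \in A) ->
  \sum_(x \in [set: T]) f x = \sum_(x <- A) f x.
Proof.
by move=> H; apply: fsbigTE => x xA; apply/eqP; apply: contraNT xA; exact: H.
Qed.

Lemma eq_fsumT f g : f =1 g -> \sum_(x \in [set: T]) f x = \sum_(x \in [set: T]) g x.
Proof. by move=> /funext ->. Qed.

Lemma fsumD f g : finsupp_fun f -> finsupp_fun g ->
  \sum_(x \in [set: T]) (f x + g x) =
  \sum_(x \in [set: T]) f x + \sum_(x \in [set: T]) g x.
Proof.
move=> ff fg.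
pose A := fset_set ([set x | f x != 0] `|` [set x | g x != 0]).
have inA x : (x \in A) = (f x != 0) || (g x != 0).
  by rewrite in_fset_set ?finite_setU //; apply/idP/orP; rewrite in_setE.
rewrite !(@fsum_on A) ?big_split // => x; rewrite inA.
- by move=> ->; rewrite orbT.
- by move=> ->.
- by apply: contraR; rewrite negb_or !negbK => /andP[/eqP-> /eqP->]; rewrite addr0.
Qed.

Lemma finsuppD f g : finsupp_fun f -> finsupp_fun g -> finsupp_fun (fun x => f x + g x).
Proof.
move=> ff fg.
have : finite_set ([set x | f x != 0] `|` [set x | g x != 0]) by rewrite finite_setU.
apply: sub_finite_set => x /=; have [->|] := eqVneq (f x) 0; last by left.
by rewrite add0r; right.
Qed.

Lemma fsum_sum (I : Type) (s : seq I) (P : pred I) (F : I -> T -> R) :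
  (forall i, P i -> finsupp_fun (F i)) ->
  \sum_(x \in [set: T]) \sum_(i <- s | P i) F i x =
  \sum_(i <- s | P i) \sum_(x \in [set: T]) F i x.
Proof.
move=> H; suff : finsupp_fun (fun x => \sum_(i <- s | P i) F i x) /\
   \sum_(x \in [set: T]) \sum_(i <- s | P i) F i x =
   \sum_(i <- s | P i) \sum_(x \in [set: T]) F i x by case.
elim: s => [|i s [fs E]].
  have e : (fun x => \sum_(i <- [::] | P i) F i x) = fun=> 0.
    by apply/funext => x; rewrite big_nil.
  split; first by rewrite e /finsupp_fun; apply: (sub_finite_set _ (@finite_set0 T)) => x /=; rewrite eqxx.
  by under eq_fsbigr do rewrite big_nil; rewrite big_nil fsbig1.
case: (boolP (P i)) => Pi; last first.
  have e x : \sum_(j <- i :: s | P j) F j x = \sum_(j <- s | P j) F j x.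
    by rewrite big_cons (negPf Pi).
  split; first by rewrite /finsupp_fun; under eq_set do rewrite e.
  by under eq_fsbigr do rewrite e; rewrite E big_cons (negPf Pi).
have e x : \sum_(j <- i :: s | P j) F j x = F i x + \sum_(j <- s | P j) F j x.
  by rewrite big_cons Pi.
split.
  rewrite /finsupp_fun; under eq_set do rewrite e; exact: finsuppD (H _ Pi) fs.
under eq_fsbigr do rewrite e; rewrite fsumD // ?E ?big_cons ?Pi //; exact: H.
Qed.

End FiniteSupport.

Lemma fsumZ (T : choiceType) (R : idomainType) (a : R) (f : T -> R) : finsupp_fun f ->
  \sum_(x \in [set: T]) a * f x = a * \sum_(x \in [set: T]) f x.
Proof.
move=> ff; pose A := fset_set [set x | f x != 0].
have inA x : (x \in A) = (f x != 0).
  by rewrite in_fset_set //; apply/idP/idP; rewrite in_setE.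
rewrite !(@fsum_on _ _ A) ?mulr_sumr // => x; rewrite inA //.
by apply: contraNN => /eqP ->; rewrite mulr0.
Qed.

Lemma finite_int_box d (N : nat) :
  finite_set [set x : 'rV[int]_d | forall j, `|x 0 j| <= N%:Z].
Proof.
pose f (y : 'rV['I_(N + N).+1]_d) : 'rV[int]_d := map_mx (fun k : 'I__ => (k : nat)%:Z - N%:Z) y.
apply: (@sub_finite_set _ _ (range f)); last exact: finite_image.
move=> x /= H; exists (map_mx (fun z : int => inord (absz (z + N%:Z))) x) => //.
apply/rowP => j; rewrite !mxE; have := H j; rewrite ler_norml => /andP[h1 h2].
have h3 : 0 <= x 0 j + N%:Z by rewrite -lerBlDr sub0r.
rewrite inordK; first by rewrite gez0_abs // addrK.
by rewrite ltnS -lez_nat gez0_abs // PoszD lerD2r.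
Qed.

Section Counting.
Context {R : realType} {d n : nat}.
Variable Z : 'M[int]_(n, d).
Local Notation V := (map_mx intr Z : 'M[R]_(n, d)).
Local Notation W := (homog V).
Local Notation basis S := (is_basis W S (basis_coord W S)).
Local Notation bary := (bary V).
Local Notation lhat t x := (hat (t%:~R : R) (lattice_point R x)).

(* For [K = S] this is the half-open parallelepiped whose translates by the
   generators tile the half-open cone. *)
Definition in_tile (S I K : {set 'I_n}) (y : 'rV[R]_(1 + d)) : bool :=
  in_halfopen V S I y &&
  [forall i in K, if i \in I then bary S y i <= 1 else bary S y i < 1].

Definition tile_count (S I K : {set 'I_n}) (t : int) : R :=
  \sum_(x \in [set: 'rV[int]_d]) ((in_tile S I K (lhat t x))%:R : R).

Lemma halfopen_ge0 S I y i : basis S -> in_halfopen V S I y -> 0 <= bary S y i.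
Proof.
move=> b /forall_inP H; case: (boolP (i \in S)) => iS; last first.
  by rewrite /bary (is_basis_out _ b iS).
by have := H i iS; case: ifP => // _ /ltW.
Qed.

Lemma tile_finsupp (S I K : {set 'I_n}) t : basis S -> finsupp_fun (fun x => (in_tile S I K (lhat t x))%:R : R).
Proof.
move=> b; pose N := \sum_i \sum_j `|t * Z i j|.
apply: (sub_finite_set _ (@finite_int_box d (absz N))) => x /=.
rewrite pnatr_eq0 eqb0 negbK => /andP[ho _] j.
have N0 : 0 <= N by apply: sumr_ge0 => i _; exact: sumr_ge0.
rewrite gez0_abs //.
have [e1 e2] := (mul_homogE _ _ _ _).1 (is_basis_mulK (lhat t x) b).
have c0 i : 0 <= bary S (lhat t x) i := halfopen_ge0 i b ho.
have ct i : bary S (lhat t x) i <= t%:~R.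
  by rewrite -[leRHS]e1 (bigD1 i) //= lerDl sumr_ge0 // => k _; exact: c0.
have : `|lattice_point R x 0 j| <= N%:~R.
  rewrite -e2 mxE (le_trans (ler_norm_sum _ _ _)) // /N rmorph_sum ler_sum // => i _.
  rewrite rmorph_sum (bigD1 j) //=.
  apply: (@le_trans _ _ (`|t * Z i j|%:~R)); last first.
    by rewrite lerDl sumr_ge0 // => k _; rewrite ler0z.
  rewrite normrM intr_norm intrM normrM [V _ _]mxE ler_wpM2r //.
  have t0 := le_trans (c0 i) (ct i).
  by rewrite ger0_norm ?c0 // ger0_norm // ct.
by rewrite mxE -intr_norm ler_int.
Qed.

Lemma lhatB t x i : lhat (t - 1) (x - row i Z) = lhat t x - row i W.
Proof.
rewrite row_homog -[X in _ = _ - X]scale1r -scaleNr hatDZ; congr hat.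
  by rewrite intrD mulN1r.
by apply/rowP => j; rewrite !mxE intrD mulN1r intrN.
Qed.

Lemma in_tile_split (S I K : {set 'I_n}) i (y : 'rV[R]_(1 + d)) : basis S -> i \in S -> i \notin K ->
  (in_tile S I K y)%:R = (in_tile S I K (y - row i W))%:R + (in_tile S I (i |: K) y)%:R :> R.
Proof.
move=> b iS iK.
have cE k : bary S (y - row i W) k = bary S y k - (k == i)%:R.
  by rewrite {1}/bary mulmxBl mxBE -(bary_vertex k b iS).
have H1 : in_tile S I (i |: K) y = in_tile S I K y && (if i \in I then bary S y i <= 1 else bary S y i < 1).
  rewrite /in_tile -andbA; congr (_ && _); apply/forall_inP/andP.
    by move=> H; split; [apply/forall_inP => k kK; apply: H; rewrite !inE kK orbT|apply: H; rewrite !inE eqxx].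
  by move=> [/forall_inP H Hi] k; rewrite !inE => /orP[/eqP->|/H].
have H2 : in_tile S I K (y - row i W) = in_tile S I K y && ~~ (if i \in I then bary S y i <= 1 else bary S y i < 1).
  have HK : [forall k in K, if k \in I then bary S (y - row i W) k <= 1 else bary S (y - row i W) k < 1] =
            [forall k in K, if k \in I then bary S y k <= 1 else bary S y k < 1].
    apply: eq_forallb_in => k kK; rewrite cE; case: eqVneq => [ki|_]; last by rewrite subr0.
    by rewrite -ki kK in iK.
  rewrite /in_tile HK andbAC; congr (_ && _); apply/forall_inP/andP.
    move=> H; split.
      apply/forall_inP => k kS; have := H k kS; rewrite cE; case: eqVneq => [_|_]; last by rewrite subr0.
      by rewrite /= mulr1n; case: ifP => _; lra.
    by have := H i iS; rewrite cE eqxx mulr1n; case: ifP => _; rewrite -?ltNge -?leNgt; lra.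
  move=> [/forall_inP H Hi] k kS; rewrite cE; case: eqVneq => [->|_]; last by rewrite subr0; exact: H.
  by move: Hi; rewrite ?mulr1n; case: ifP => _; rewrite -?ltNge -?leNgt; lra.
by rewrite H1 H2; case: in_tile; case: (if _ then _ else _); rewrite /= ?addr0 ?add0r.
Qed.

Lemma tile_count_diff (S I K : {set 'I_n}) i t : basis S -> i \in S -> i \notin K ->
  tile_count S I (i |: K) t = tile_count S I K t - tile_count S I K (t - 1).
Proof.
move=> b iS iK.
have e : tile_count S I K (t - 1) = \sum_(x \in [set: 'rV[int]_d]) ((in_tile S I K (lhat t x - row i W))%:R : R).
  have bij : bijective (fun x : 'rV[int]_d => x - row i Z).
    by exists (fun x => x + row i Z) => x; rewrite ?subrK ?addrK.
  rewrite /tile_count (reindex_fsbigT _ _ bij).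
  by rewrite /tile_count; apply: eq_fsumT => x; rewrite lhatB.
have -> : tile_count S I K t = \sum_(x \in [set: 'rV[int]_d])
    ((in_tile S I K (lhat t x - row i W))%:R + (in_tile S I (i |: K) (lhat t x))%:R : R).
  by apply: eq_fsumT => x; exact: in_tile_split.
rewrite e fsumD; first by rewrite addrAC subrr add0r.
- have := tile_finsupp I (i |: K) t b; have := tile_finsupp I K t b.
  move=> f1 f2; apply: sub_finite_set f1 => x /=.
  rewrite (in_tile_split I (lhat t x) b iS iK) -natrD !pnatr_eq0 addn_eq0 negb_and => ->.
  by rewrite orTb.
- exact: tile_finsupp.
Qed.

Lemma tile_count_lt0 (S I K : {set 'I_n}) t : basis S -> t < 0 -> tile_count S I K t = 0.
Proof.
move=> b t0; rewrite /tile_count fsbig1 // => x _.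
suff -> : in_tile S I K (lhat t x) = false by [].
apply/negP => /andP[ho _].
have : 0 <= t%:~R :> R.
  rewrite -(sum_bary t%:~R (lattice_point R x) b).
  by apply: sumr_ge0 => i _; exact: halfopen_ge0 b ho.
by rewrite ler0z leNgt t0.
Qed.

Lemma tile_count_ge0 (S I K : {set 'I_n}) t : 0 <= tile_count S I K t.
Proof. by apply: fsumr_ge0 => x _; exact: ler0n. Qed.

(* Restricting one more coordinate to the unit interval multiplies the generating
   function by [1 - z]. *)
Lemma tile_count_conv (S I K : {set 'I_n}) m : basis S -> K \subset S ->
  \sum_(i < m.+1) tile_count S I finset.set0 i%:Z * ((1 - 'X) ^+ #|K| : {poly R})`_(m - i) =
  tile_count S I K m%:Z.
Proof.
move=> b; move: {2}#|K| (erefl #|K|) m => k; elim: k K => [|k IH] K cK m KS.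
  have -> : K = finset.set0 by apply/eqP; rewrite -cards_eq0 cK.
  rewrite cards0 expr0 big_ord_recr /= subnn coefC eqxx mulr1 big1 ?add0r // => i _.
  by rewrite coefC subn_eq0 leqNgt ltn_ord /= mulr0.
have [i iK] : exists i, i \in K by apply/card_gt0P; rewrite cK.
have KE : K = i |: (K :\ i) by rewrite finset.setD1K.
have cK' : #|K :\ i| = k by have := cardsD1 i K; rewrite iK cK add1n => -[].
have KS' : K :\ i \subset S by rewrite (fintype.subset_trans _ KS) // subsetDl.
have iK' : i \notin K :\ i by rewrite !inE eqxx.
have iS := fintype.subsetP KS i iK.
rewrite [in RHS]KE tile_count_diff // cK exprSr.
rewrite -(IH (K :\ i) cK') // cK'.
under eq_bigr do rewrite mulrBr mulr1 coefB coefMX mulrBr.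
rewrite sumrB; congr (_ - _).
rewrite big_ord_recr /= subnn /= mulr0 addr0.
case: m => [|m]; first by rewrite big_ord0 tile_count_lt0.
rewrite (_ : m.+1%:Z - 1 = m%:Z); last by rewrite -addn1 PoszD addrK.
rewrite -(IH (K :\ i) cK') // cK'; apply: eq_bigr => j _.
by rewrite subSn // -ltnS.
Qed.

Lemma tile_count0 (S I : {set 'I_n}) : basis S -> I != finset.set0 -> I \subset S ->
  tile_count S I finset.set0 0 = 0.
Proof.
move=> b In0 IS; rewrite /tile_count fsbig1 // => x _.
suff -> : in_tile S I finset.set0 (lhat 0 x) = false by [].
apply/negP => /andP[ho _]; have [i iI] := set0Pn _ In0.
have iS := fintype.subsetP IS i iI.
have := sum_bary 0%:~R (lattice_point R x) b; apply/eqP; rewrite gt_eqF //.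
rewrite (bigD1 i) //= ltr_pwDl //; last by apply: sumr_ge0 => k _; exact: halfopen_ge0 b ho.
by have := forall_inP ho i iS; rewrite iI.
Qed.

Lemma tile_count_last (S I : {set 'I_n}) : basis S -> I \proper S ->
  tile_count S I S d.+1%:Z = 0.
Proof.
move=> b /properP[IS [k kS kI]]; rewrite /tile_count fsbig1 // => x _.
suff -> : in_tile S I S (lhat d.+1 x) = false by [].
apply/negP => /andP[_ /forall_inP H].
have := sum_bary d.+1%:Z%:~R (lattice_point R x) b; apply/eqP; rewrite lt_eqF //.
apply: (@lt_le_trans _ _ (\sum_(i in S) 1)).
  rewrite (bigD1 k) //= [ltRHS](bigD1 k) //= ltr_leD //.
    by have := H k kS; rewrite (negPf kI).
  by apply: ler_sum => i /andP[iS _]; have := H i iS; case: ifP => // _ /ltW.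
by rewrite sumr_const (card_basis b) -pmulrn.
Qed.

Lemma tile_count_gt0 (S I : {set 'I_n}) : basis S -> I \subset S ->
  0 < tile_count S I S #|I|%:Z.
Proof.
move=> b IS; pose c : 'rV[int]_n := \row_i (i \in I)%:R.
pose x : 'rV[int]_d := c *m Z.
have cW : map_mx intr c *m W = lhat #|I|%:Z x.
  apply/mul_homogE; split; last by rewrite /lattice_point map_mxM.
  rewrite (eq_bigr (fun i => if i \in I then 1 else 0)); last first.
    by move=> i _; rewrite !mxE; case: ifP.
  by rewrite -big_mkcond sumr_const -pmulrn.
have cE i : bary S (lhat #|I|%:Z x) i = (i \in I)%:R.
  rewrite /bary -cW (is_basis_unique b) ?mxE ?mxE; first by case: (i \in I).
  by move=> k kS; rewrite !mxE (negPf (contra (fintype.subsetP IS k) kS)).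
rewrite /tile_count.
have hx : in_tile S I S (lhat #|I|%:Z x).
  by apply/andP; split; apply/forall_inP => i iS; rewrite cE; case: (i \in I); rewrite ?ltr01 ?lexx.
pose A := fset_set [set x | ((in_tile S I S (lhat #|I|%:Z x))%:R : R) != 0].
have inA y : (y \in A) = in_tile S I S (lhat #|I|%:Z y).
  rewrite in_fset_set; last exact: tile_finsupp.
  by apply/idP/idP; rewrite in_setE /= pnatr_eq0 eqb0 negbK.
rewrite (@fsum_on _ _ A); last by move=> y; rewrite pnatr_eq0 eqb0 negbK inA.
have xA : x \in A by rewrite inA.
rewrite (big_fsetD1 x) //= hx ltr_pwDl ?ltr01 //.
by apply: sumr_ge0.
Qed.

End Counting.

Lemma solid_angle_sum_tiles (R : realType) d n (Z : 'M[int]_(n, d))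
    (V := map_mx intr Z : 'M[R]_(n, d)) (h : 'cV[R]_n) (t : nat) :
  (0 < d)%N -> row_full (homog V) -> generic_height (homog V) h -> (0 < t)%N ->
  solid_angle_sum (hull V) t =
  \sum_(J : {set 'I_n} * {set 'I_n} | (J.1 \in cells V h) && (J.2 \subset J.1))
    direction_prob V J.1 J.2 * @tile_count R d n Z J.1 J.2 finset.set0 t.
Proof.
move=> d0 fV gh t0; rewrite /solid_angle_sum.
pose F (J : {set 'I_n} * {set 'I_n}) (x : 'rV[int]_d) : R :=
  (in_tile Z J.1 J.2 finset.set0 (hat (t%:~R : R) (lattice_point R x)))%:R.
have FJ (J : {set 'I_n} * {set 'I_n}) : (J.1 \in cells V h) && (J.2 \subset J.1) -> finsupp_fun (F J).
  by move=> /andP[SC _]; exact/tile_finsupp/cells_basis/SC.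
transitivity (\sum_(x \in [set: 'rV[int]_d])
  \sum_(J : {set 'I_n} * {set 'I_n} | (J.1 \in cells V h) && (J.2 \subset J.1))
    direction_prob V J.1 J.2 * F J x).
  apply: eq_fsumT => x; rewrite (solid_angle_dilate d0 fV gh _ t0).
  apply: eq_bigr => J _; congr (_ * _%:R); rewrite /in_tile.
  by rewrite (_ : [forall i in finset.set0, _]) ?andbT //; apply/forall_inP => i; rewrite inE.
rewrite fsum_sum => [|J /FJ fJ].
  by apply: eq_bigr => J /FJ fJ; rewrite fsumZ.
apply: sub_finite_set fJ => x /=; apply: contraNN => /eqP ->.
by rewrite mulr0.
Qed.

Lemma coef_exp1BX_neq0 (R : idomainType) k : ((1 - 'X) ^+ k : {poly R})`_k != 0.
Proof.
have -> : (1 - 'X : {poly R}) = - ('X - 1%:P) by rewrite opprB.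
have E : (('X - 1%:P) ^+ k : {poly R})`_k = 1.
  have /monicP := monic_exp k (monicXsubC (1 : R)).
  by rewrite lead_coefE size_exp_XsubC.
rewrite exprNn -signr_odd; case: (odd k); rewrite ?expr1 ?expr0 ?mulN1r ?mul1r ?coefN E.
  by rewrite oppr_eq0 oner_eq0.
exact: oner_neq0.
Qed.

Theorem theorem5p1 (R : realType) (d : nat) (hd : (0 < d)%N)
    (P : set 'rV[R]_d) (hP : lattice_polytope P) (hdim : has_dim P d)
    (A : {poly R}) (hA : is_solid_angle_poly P A)
    (a : nat -> R)
    (ha : gen_fun_eq (fun t : nat => A.[t%:R])
            (\poly_(j < d.+1) a j) ((1 - 'X) ^+ d.+1)) :
  (forall j : nat, (1 <= j <= d)%N -> 0 < a j) /\ a 0%N = 0.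
Proof.
have [n [Z PE]] := lattice_polytope_hull hP.
rewrite {}PE in hdim hA.
set V := map_mx intr Z in hdim hA.
have fV := row_full_homog hdim.
have [h gh] := ex_generic_height (homog V).
pose ok (J : {set 'I_n} * {set 'I_n}) := (J.1 \in cells V h) && (J.2 \subset J.1).
pose p (J : {set 'I_n} * {set 'I_n}) := direction_prob V J.1 J.2.
pose B t := \sum_(J | ok J) p J * @tile_count R d n Z J.1 J.2 finset.set0 t.
pose N j := \sum_(J | ok J) p J * @tile_count R d n Z J.1 J.2 J.1 j.
have okb J : ok J -> is_basis (homog V) J.1 (basis_coord (homog V) J.1).
  by move=> /andP[SC _]; exact: cells_basis SC.
have B0 : B 0 = 0.
  rewrite /B big1 // => J okJ; have [_ IS] := andP okJ; have b := okb _ okJ.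
  have [I0|In0] := eqVneq J.2 finset.set0.
    by rewrite /p I0 direction_prob_set0 // mul0r.
  by rewrite tile_count0 // mulr0.
have NE m : \sum_(i < m.+1) B i%:Z * ((1 - 'X) ^+ d.+1 : {poly R})`_(m - i) = N m%:Z.
  rewrite /B /N; under eq_bigr do rewrite mulr_suml.
  rewrite exchange_big; apply: eq_bigr => J okJ; have b := okb _ okJ.
  rewrite -(@tile_count_conv _ _ _ _ _ _ J.1) ?fintype.subxx // mulr_sumr (card_basis b).
  by apply: eq_bigr => i _; rewrite mulrA.
have N_last : N d.+1%:Z = 0.
  rewrite /N big1 // => J okJ; have [_ IS] := andP okJ; have b := okb _ okJ.
  have [IE|IN] := eqVneq J.2 J.1; first by rewrite /p IE direction_prob_id // mul0r.
  by rewrite tile_count_last ?mulr0 // finset.properEneq IN.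
have AE m : A.[m%:R] = B m%:Z + A.[0] * (m == 0)%:R.
  case: m => [|m]; first by rewrite B0 add0r mulr1.
  by rewrite mulr0 addr0 hA // (solid_angle_sum_tiles hd fV gh).
have numE m : (\poly_(j < d.+1) a j)`_m = N m%:Z + A.[0] * ((1 - 'X) ^+ d.+1 : {poly R})`_m.
  rewrite -ha -NE; under eq_bigr do rewrite AE mulrDl.
  rewrite big_split /=; congr (_ + _); rewrite big_ord_recl /= subn0 mulr1.
  by rewrite big1 ?addr0 // => i _; rewrite mulr0 mul0r.
have A0 : A.[0] = 0.
  have := numE d.+1; rewrite coef_poly ltnn N_last add0r => /esym/eqP.
  by rewrite mulf_eq0 (negPf (coef_exp1BX_neq0 _ _)) orbF => /eqP.
have aE m : (m <= d)%N -> a m = N m%:Z.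
  by move=> md; have := numE m; rewrite coef_poly ltnS md A0 mul0r addr0.
have N0 : N 0 = 0 by rewrite -[0]/(0%:Z) -NE big_ord1 B0 mul0r.
split; last by rewrite aE.
move=> j /andP[j1 jd]; rewrite aE //.
have [S SC] := cells_neq0 hd fV gh.
have b := cells_basis SC.
pose I : {set 'I_n} := [set x in take j (enum S)].
have IS : I \subset S.
  by apply/fintype.subsetP => x; rewrite inE => /mem_take; rewrite mem_enum.
have cI : #|I| = j.
  rewrite cardsE (card_uniqP (take_uniq _ (enum_uniq _))) size_take -cardE (card_basis b).
  by rewrite ltnS jd.
have okJ : ok (S, I) by rewrite /ok /= SC.
rewrite /N (bigD1 (S, I)) //= ltr_pwDl //.
  rewrite mulr_gt0 //; last by rewrite -cI tile_count_gt0.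
  by apply: direction_prob_gt0; rewrite ?cI ?(card_basis b).
by apply: sumr_ge0 => J _; rewrite mulr_ge0 ?direction_prob_ge0 ?tile_count_ge0.
Qed.
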